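(* Let $3\le n\le\infty$ and let $\Gamma\le \mathrm{Sym}(n)$ be an arbitrary permutation group of $[n]$. Let $\mathcal{K}(\Gamma)\le \mathrm{Homeo}(D_n)$ be the kaleidoscopic group with local action $\Gamma$, viewed also as a permutation group of the countable set $\mathrm{Br}(D_n)$. Then: (i) The abstract group $\mathcal{K}(\Gamma)$ is simple and uniformly perfect. (ii) The permutation group $\mathcal{K}(\Gamma)$ of $\mathrm{Br}(D_n)$ is always primitive; it is doubly transitive if and only if $\Gamma$ is transitive on $[n]$. (iii) The permutation group $\mathcal{K}(\Gamma)$ of $\mathrm{Br}(D_n)$ is never doubly primitive. More precisely, for every $x\in \mathrm{Br}(D_n)$ the action of the point-stabilizer $\mathcal{K}(\Gamma)_x$ on $\mathrm{Br}(D_n)\setminus\{x\}$ admits a system of imprimitivity, namely the partition into the sets $V\cap \mathrm{Br}(D_n)$ for $V\in\widehat{x}$, such that the permutation group induced by $\mathcal{K}(\Gamma)_x$ on the set of blocks is isomorphic, as a permutation group, to $(\Gamma,[n])$; and $\mathcal{K}(\Gamma)_x$ is isomorphic to the (unrestricted) permutational wreath product $\bigl(\prod_{V\in\widehat{x}} \mathrm{Rist}(V)\bigr)\rtimes\Gamma$, in which $\Gamma$ permutes the (mutually isomorphic) factors via its action on $[n]\cong\widehat{x}$, and $\mathrm{Rist}(V)=\{g\in\mathcal{K}(\Gamma): g(y)=y \text{ for all } y\notin V\}$.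
   Context: A dendrite is a locally connected continuum (non-empty compact connected metrizable space) containing no simple closed curve. Any two distinct points $x,y$ of a dendrite $X$ are joined by a unique arc $[x,y]$; put $(x,y)=[x,y]\setminus\{x,y\}$. For $x\in X$, $\widehat{x}=\pi_0(X\setminus\{x\})$ is the (at most countable) set of components of $X\setminus\{x\}$; $x$ is a branch point if $|\widehat{x}|\ge 3$, and $\mathrm{Br}(X)$ is the (at most countable) set of branch points. For $3\le n\le\infty$ ($\infty$ meaning countably infinite), the Ważewski dendrite $D_n$ is the dendrite, unique up to homeomorphism, which is not a single point, in which $|\widehat{x}|=n$ for every branch point $x$, and in which $(x,y)$ contains a branch point for all $x\ne y$. Write $[n]=\{m\in\mathbf{N}: m<n\}$ (so $[\infty]=\mathbf{N}\ni 0$) and $\mathrm{Sym}(n)$ for the group of all permutations of $[n]$. A coloring of $D_n$ is a map $c$ from $\widehat{D_n}=\bigsqcup_{x\in\mathrm{Br}(D_n)}\widehat{x}$ to $[n]$ whose restriction $c_x=c|_{\widehat{x}}$ is a bijection $\widehat{x}\to[n]$ for each $x\in \mathrm{Br}(D_n)$; for $y\ne x$, $c_x(y)$ denotes the color of the component of $D_n\setminus\{x\}$ containing $y$. The coloring is kaleidoscopic if for all distinct $x,y\in\mathrm{Br}(D_n)$ and all distinct $i,j\in[n]$ there is $z\in(x,y)\cap\mathrm{Br}(D_n)$ with $c_z(x)=i$ and $c_z(y)=j$. For $g\in\mathrm{Homeo}(D_n)$ and $x\in\mathrm{Br}(D_n)$ put $\sigma_c(g,x)=c_{g(x)}\circ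 g\circ c_x^{-1}\in\mathrm{Sym}(n)$, where $g$ is viewed as a bijection $\widehat{x}\to\widehat{g(x)}$. For $\Gamma\le\mathrm{Sym}(n)$ put $\mathcal{K}_c(\Gamma)=\{g\in\mathrm{Homeo}(D_n):\sigma_c(g,x)\in\Gamma\ \text{for all } x\in\mathrm{Br}(D_n)\}$. Kaleidoscopic colorings exist and for any two of them, $c$ and $d$, the groups $\mathcal{K}_c(\Gamma)$ and $\mathcal{K}_d(\Gamma)$ are conjugate in $\mathrm{Homeo}(D_n)$; $\mathcal{K}(\Gamma)$ denotes $\mathcal{K}_c(\Gamma)$ for some (any) kaleidoscopic coloring $c$. It acts faithfully on $\mathrm{Br}(D_n)$. A group is uniformly perfect if there is an integer $k$ such that every element is a product of $k$ commutators. An action on a set $X$ is primitive if it is transitive and preserves no equivalence relation on $X$ other than equality and $X\times X$; a system of imprimitivity is an invariant partition into at least two blocks of at least two points each. An action on $X$ is doubly transitive (respectively doubly primitive) if it is transitive and each point stabilizer $G_x$ acts transitively (respectively primitively) on $X\setminus\{x\}$. Two permutation groups are isomorphic if a bijection of the underlying sets conjugates one onto the other. *)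

(* Defs.v *)
From HB Require Import structures.
From mathcomp Require Import all_boot all_order all_algebra.
From mathcomp Require Import all_classical all_reals all_analysis.
Import numFieldNormedType.Exports.

Set Implicit Arguments.
Unset Strict Implicit.
Unset Printing Implicit Defensive.

Local Open Scope classical_set_scope.
Local Open Scope card_scope.

Record sym (T : Type) := Sym {
  sym_fun :> T -> T;
  sym_inv : T -> T;
  sym_funK : cancel sym_fun sym_inv;
  sym_invK : cancel sym_inv sym_fun }.

Section SymGroup.
Variable T : Type.
Implicit Types p q r : sym T.

Lemma symP p q : p =1 q -> p = q.
Proof.
case: p q => f f' fK f'K [g g' gK g'K] /= /funext efg; subst g.
have e : f' = g' by apply/funext => x; rewrite -{1}(g'K x) fK.
by subst g'; congr Sym; exact: Prop_irrelevance.
Qed.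

Definition sym_one : sym T := @Sym T id id (fun=> erefl) (fun=> erefl).
Definition sym_mul p q : sym T :=
  Sym (can_comp (sym_funK p) (sym_funK q)) (can_comp (sym_invK q) (sym_invK p)).
Definition sym_opp p : sym T := Sym (sym_invK p) (sym_funK p).

HB.instance Definition _ := gen_eqMixin (sym T).
HB.instance Definition _ := gen_choiceMixin (sym T).

Fact sym_mulA : associative sym_mul. Proof. by move=> *; exact: symP. Qed.
Fact sym_mul1 : left_id sym_one sym_mul. Proof. by move=> *; exact: symP. Qed.
Fact sym_1mul : right_id sym_one sym_mul. Proof. by move=> *; exact: symP. Qed.
Fact sym_mulV : left_inverse sym_one sym_opp sym_mul.
Proof. by move=> p; apply: symP => x /=; rewrite sym_funK. Qed.
Fact sym_Vmul : right_inverse sym_one sym_opp sym_mul.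
Proof. by move=> p; apply: symP => x /=; rewrite sym_invK. Qed.

HB.instance Definition _ :=
  isGroup.Build (sym T) sym_mulA sym_mul1 sym_1mul sym_mulV sym_Vmul.

(* The group law is composition of functions, in contrast with the
   left-to-right convention of {perm T}. *)
Lemma sym_mulE p q x : (p * q)%g x = p (q x). Proof. by []. Qed.

End SymGroup.

Section AbstractGroups.
Local Open Scope group_scope.

Definition subgroup (gT : groupType) (G : set gT) : Prop :=
  group_closed [in G].

Definition normal_in (gT : groupType) (N G : set gT) : Prop :=
  [/\ subgroup N, N `<=` G & forall g h, G g -> N h -> N (h ^ g)].

Definition simple_group (gT : groupType) (G : set gT) : Prop :=
  [/\ subgroup G, G <> [set 1]
    & forall N : set gT, normal_in N G -> N = [set 1] \/ N = G].

Definition uniformly_perfect (gT : groupType) (G : set gT) : Prop :=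
  exists k : nat, forall g, G g -> exists a b : 'I_k -> gT,
    (forall i, G (a i) /\ G (b i)) /\ g = \prod_(i < k) [~ a i, b i].

Definition iso_between (gT hT : groupType) (G : set gT) (H : set hT)
    (f : gT -> hT) : Prop :=
  set_bij G H f /\ (forall x y, G x -> G y -> f (x * y) = f x * f y).

(* Permutational wreath product. The group Gamma <= Sym(I) permutes the factors
   of the unrestricted product of the groups A i, i : I, which are identified
   with one another by a coherent system phi of isomorphisms. With the action
   (s . f) i = phi (s^-1 i) i (f (s^-1 i)), the law of the semidirect product is
   (f, s) (f', s') = (f (s . f'), s s'). *)
Definition coherent_isoms (gT : groupType) (I : Type) (A : I -> set gT)
    (phi : I -> I -> gT -> gT) : Prop :=
  [/\ forall i j, iso_between (A i) (A j) (phi i j),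
      forall i a, A i a -> phi i i a = a
    & forall i j k a, A i a -> phi j k (phi i j a) = phi i k a].

Definition wreath (gT : groupType) (I : Type) (A : I -> set gT)
    (Gamma : set (sym I)) : set ((I -> gT) * sym I) :=
  [set u | (forall i, A i (u.1 i)) /\ Gamma u.2].

Definition wreath_mul (gT : groupType) (I : Type) (phi : I -> I -> gT -> gT)
    (u v : (I -> gT) * sym I) : (I -> gT) * sym I :=
  (fun i => u.1 i * phi (u.2^-1 i) i (v.1 (u.2^-1 i)), u.2 * v.2).

Definition isog_wreath (gT : groupType) (G : set gT) (I : Type)
    (A : I -> set gT) (Gamma : set (sym I)) : Prop :=
  exists2 phi, coherent_isoms A phi &
  exists F : (I -> gT) * sym I -> gT,
    set_bij (wreath A Gamma) G F /\
    (forall u v, wreath A Gamma u -> wreath A Gamma v ->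
       F (wreath_mul phi u v) = F u * F v).

End AbstractGroups.

(* A permutation group on T is given by a subgroup P : set (sym T). *)

(* The permutation group induced on a G-invariant set Y by the action act. *)
Definition induced_perms (gT S : Type) (G : set gT) (act : gT -> S -> S)
    (Y : set S) : set (sym Y) :=
  [set p | exists2 g, G g & forall y : Y, val (p y) = act g (val y)].

Arguments induced_perms {gT S} G act Y _.

Section PermutationGroups.
Variable T : Type.
Implicit Types (P : set (sym T)) (x y : T).

Definition stabilizer P x : set (sym T) := [set p | P p /\ p x = x].

Definition point_action : sym T -> T -> T := fun p => p.
Definition image_action : sym T -> set T -> set T := fun p B => p @` B.

Definition perm_transitive P : Prop := forall x y, exists2 p, P p & p x = y.

Definition is_equivalence (E : T -> T -> Prop) : Prop :=
  [/\ forall x, E x x, forall x y, E x y -> E y x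
    & forall x y z, E x y -> E y z -> E x z].

Definition perm_primitive P : Prop :=
  perm_transitive P /\
  forall E : T -> T -> Prop, is_equivalence E ->
    (forall p x y, P p -> E x y <-> E (p x) (p y)) ->
    (forall x y, E x y <-> x = y) \/ (forall x y, E x y).

Definition system_of_imprimitivity P (F : set (set T)) : Prop :=
  [/\ partition F id [set: T],
      forall p B, P p -> F B -> F (image_action p B),
      exists B C, [/\ F B, F C & B <> C]
    & forall B, F B -> exists x y, [/\ B x, B y & x <> y]].

End PermutationGroups.

Definition doubly_transitive (T : Type) (P : set (sym T)) : Prop :=
  perm_transitive P /\
  forall x, perm_transitive
    (induced_perms (stabilizer P x) (@point_action T) (~` [set x])).

Definition doubly_primitive (T : Type) (P : set (sym T)) : Prop :=
  perm_transitive P /\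
  forall x, perm_primitive
    (induced_perms (stabilizer P x) (@point_action T) (~` [set x])).

Definition perm_isomorphic (S T : Type) (P : set (sym S)) (Q : set (sym T)) :=
  exists2 f : S -> T, bijective f &
    forall q : sym T, Q q <-> exists2 p, P p & forall s, q (f s) = f (p s).

Section Topology.
Local Open Scope ring_scope.

Definition homeomorphism (T U : topologicalType) (A : set T) (B : set U)
    (f : T -> U) (g : U -> T) : Prop :=
  [/\ {within A, continuous f}, {within B, continuous g},
      set_fun A B f, set_fun B A g
    & (forall x, A x -> g (f x) = x) /\ (forall y, B y -> f (g y) = y)].

Definition homeomorphic (T U : topologicalType) (A : set T) (B : set U) :=
  exists f g, homeomorphism A B f g.

Definition metrizable (R : realType) (X : topologicalType) : Prop :=
  exists M : metricType R, homeomorphic [set: X] [set: M].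

Definition locally_connected (X : topologicalType) : Prop :=
  forall (x : X) (U : set X), nbhs x U ->
    exists V : set X, [/\ open V, V x, connected V & V `<=` U].

Definition unit_circle (R : realType) : set (R * R)%type :=
  [set p | p.1 ^+ 2 + p.2 ^+ 2 = 1].

Definition dendrite (R : realType) (X : topologicalType) : Prop :=
  [/\ [set: X] !=set0 /\ compact [set: X], connected [set: X],
      metrizable R X, locally_connected X
    & ~ exists S : set X, homeomorphic (@unit_circle R) S].

Definition is_arc (R : realType) (X : topologicalType) (x y : X) (A : set X) :=
  exists f g, [/\ homeomorphism (`[0, 1]%classic : set R) A f g,
                  f 0 = x & f 1 = y].

(* [x, y] and (x, y), for distinct points x and y of a dendrite *)
Definition segment (R : realType) (X : topologicalType) (x y : X) : set X :=
  xget set0 [set A | is_arc R x y A].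

Definition open_segment (R : realType) (X : topologicalType) (x y : X) : set X :=
  segment R x y `\` [set x; y].

End Topology.

(* The component of X \ {x} containing y, for y != x. *)
Definition comp_at (X : topologicalType) (x y : X) : set X :=
  connected_component (~` [set x]) y.

Definition hat (X : topologicalType) (x : X) : set (set X) :=
  [set comp_at x y | y in ~` [set x]].

Definition Br (X : topologicalType) : set X :=
  [set x | [set: 'I_3] #<= hat x].

(* [n] for n : option nat, where None stands for infinity *)
Definition idx (n : option nat) : Type := if n is Some m then 'I_m else nat.

Definition three_le (n : option nat) : bool :=
  if n is Some m then (3 <= m)%N else true.

Definition wazewski (R : realType) (n : option nat) (X : topologicalType) :=
  [/\ dendrite R X,
      exists x y : X, x <> y,
      forall x : X, Br x -> hat x #= [set: idx n]
    & forall x y : X, x <> y -> exists z, open_segment R x y z /\ Br z].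

Section Kaleidoscopic.
Variables (n : option nat) (X : topologicalType).

(* c x V is the color of V; it is meaningful only for x in Br X and V in hat x. *)
Implicit Type c : X -> set X -> idx n.

Definition coloring c : Prop :=
  forall x, Br x -> set_bij (hat x) [set: idx n] (c x).

Definition kaleidoscopic (R : realType) c : Prop :=
  coloring c /\
  forall (x y : X) (i j : idx n), Br x -> Br y -> x <> y -> i <> j ->
    exists z, [/\ open_segment R x y z, Br z,
                  c z (comp_at z x) = i & c z (comp_at z y) = j].

(* c_x^-1 *)
Definition component_of_color c (x : X) (i : idx n) : set X :=
  xget set0 [set V | hat x V /\ c x V = i].

Definition Homeo : set (sym X) :=
  [set g : sym X | continuous (g : X -> X) /\ continuous (g^-1%g : X -> X)].

Definition local_action c (g : sym X) (x : X) : idx n -> idx n :=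
  fun i => c (g x) (g @` component_of_color c x i).

Definition kaleido_group c (Gamma : set (sym (idx n))) : set (sym X) :=
  [set g | Homeo g /\ forall x, Br x ->
     exists2 s : sym (idx n), Gamma s & s =1 local_action c g x].

Definition Rist (G : set (sym X)) (V : set X) : set (sym X) :=
  [set g | G g /\ forall y, ~ V y -> g y = y].

End Kaleidoscopic.

(* G as a permutation group of the set Y. *)
Notation perm_group_on G Y := (induced_perms G (@point_action _) Y).

(* The trace of the subsets of X in F on the subset Y, seen as a type. *)
Definition traces (X : Type) (F : set (set X)) (Y : set X) : set (set Y) :=
  [set [set y : Y | V (val y)] | V in F].
Arguments traces {X} F Y _.

(* Main.v *)
Require Import Defs.
From HB Require Import structures.
From mathcomp Require Import all_boot all_order all_algebra finmap.
From mathcomp Require Import all_classical all_reals all_analysis.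
Import Order.TTheory numFieldNormedType.Exports.
Local Open Scope classical_set_scope.

(** By the kaleidoscopic property, distinct points of the dendrite are separated
    by a branch point, so the topology is generated by the components at branch
    points, and a bijection of [Br X] preserving betweenness extends uniquely
    to a homeomorphism (by compactness).  Hence the group is the group of
    automorphisms of the set [Br X] equipped with the colors
    [k x y = c_x(y)], up to a recoloring in [Gamma] at each point.

    In that structure a back-and-forth argument, on finite partial isomorphisms
    with median-closed domain, gives elements with prescribed values at two
    points and prescribed local actions there.  An element supported in a
    half-tree is a commutator by an infinite swindle, and every element is a
    product of two such, whence uniform perfectness; simplicity follows by the
    usual double commutator trick. *)

(** The group theory takes place in an abstract [ktree], without topology; the dendrite serves to
    supply its axioms and to turn automorphisms of the branch points back into homeomorphisms. The
    difficulty is that Gamma is arbitrary, possibly trivial. Translations and conjugators are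
    therefore chosen color preserving. A prescribed local action is obtained by recoloring the
    source tree at the point concerned, so that one back-and-forth between two colorings covers all
    cases. Membership in the group is a condition at each point separately. Hence automorphisms can
    be restricted to half-trees and glued, even infinitely many at once, which is what the swindle
    needs. Splitting [g] into two supported factors amounts to finding [h], supported in a
    half-tree, that agrees with [g] on another half-tree: then [h^-1 g] is trivial on the latter, so
    it is supported in a half-tree as well. Medians of branch points are obtained from
    connectedness, as boundary points of a union of components. *)

Set Implicit Arguments.
Unset Strict Implicit.
Unset Printing Implicit Defensive.

(* At cost 0, because [done] calls [trivial]. *)
#[local] Hint Extern 0 (_ <> _) => (apply: not_eq_sym; assumption) : core.

(** * Trees with colored directions *)

(* [k x y] stands for the component of [y] in the complement of [x], or for its
   color; the value [k x x] is junk. *)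
Definition pretree (T I : Type) (k : T -> T -> I) : Prop :=
  forall x y z, x <> z -> y <> z -> k z x <> k z y -> k x z = k x y.

Definition separates (T I : Type) (k : T -> T -> I) (z x y : T) : Prop :=
  [/\ z <> x, z <> y & k z x <> k z y].

(** The interface between dendrite and group theory, to which countability and three colors are
    added later. The three equalities in [ktree_median] say that none of the points separates the
    other two, so that they branch at a fourth point. [ktree_between] is the kaleidoscopic property,
    [ktree_color] the surjectivity of the local colorings. *)
Record ktree (T I : Type) (k : T -> T -> I) : Prop := KTree {
  ktree_pretree : pretree k;
  ktree_median : forall x y z, x <> y -> x <> z -> y <> z ->
    k x y = k x z -> k y x = k y z -> k z x = k z y ->
    exists m, [/\ separates k m x y, separates k m x z & separates k m y z];
  ktree_between : forall x y i j, x <> y -> i <> j ->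
    exists z, [/\ z <> x, z <> y, k z x = i & k z y = j];
  ktree_color : forall x i, exists2 y, y <> x & k x y = i }.

Arguments ktree_pretree {T I k} _.

Section Pretree.
Variables (T I : Type) (k : T -> T -> I).
Hypothesis kP : pretree k.
Implicit Types x y z w : T.
Local Notation sep := (separates k).

Lemma sepC z x y : sep z x y -> sep z y x.
Proof. by case=> zx zy d; split=> // e; apply: d. Qed.

Lemma sep_neq z x y : sep z x y -> x <> y.
Proof. by case=> _ _ d e; apply: d; rewrite e. Qed.

Lemma sep_gate z x y : sep z x y -> k x z = k x y.
Proof. by case=> zx zy d; apply: kP. Qed.

Lemma sep_gater z x y : sep z x y -> k y z = k y x.
Proof. by move/sepC/sep_gate. Qed.

Lemma sep_trans x y z w : sep z x y -> sep w x z -> sep w x y.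
Proof.
move=> s s'; have [zx zy dz] := s; have [wx wz dw] := s'.
have e : k z w = k z x by exact: sep_gater s'.
have wy : w <> y by move=> wy; apply: dz; rewrite -e wy.
have e' : k w z = k w y by apply: kP => //; rewrite e.
by split=> //; rewrite -e'.
Qed.

Lemma sep_far x y z w : sep z x y -> sep w x z -> sep z w y /\ k w y = k w z.
Proof.
move=> s s'; have [zx zy dz] := s; have [wx wz dw] := s'.
have e : k z w = k z x by exact: sep_gater s'.
split; first by split=> //; rewrite e.
have wy : w <> y by move=> wy; apply: dz; rewrite -e wy.
by symmetry; apply: kP => //; rewrite e.
Qed.

End Pretree.

Section KTree.
Variables (T I : Type) (k : T -> T -> I).
Hypothesis kP : ktree k.
Implicit Types x y z w : T.
Local Notation sep := (separates k).
Hypothesis I2 : exists i j : I, i <> j.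

Lemma ktree_other (i : I) : exists j, j <> i.
Proof.
have [a [b ab]] := I2; have [e|e] := pselect (a = i); last by exists a.
by exists b => e'; apply: ab; rewrite e.
Qed.

Lemma ktree_betweenP x y i j : x <> y -> i <> j ->
  exists z, [/\ sep z x y, k z x = i, k z y = j,
    k x z = k x y & k y z = k y x].
Proof.
move=> xy ij; have [z [zx zy e1 e2]] := ktree_between kP xy ij.
have s : sep z x y by split=> //; rewrite e1 e2.
exists z; split=> //; first exact: (sep_gate (ktree_pretree kP) s).
exact: (sep_gater (ktree_pretree kP) s).
Qed.

(** A point in direction [i] may see [x] in a wrong color. Some point between it and [x] sees [x] in
    color [j], and it still lies in direction [i]. *)
Lemma ktree_colors x i j : exists y, [/\ y <> x, k x y = i & k y x = j].
Proof.
have [y yx e] := ktree_color kP x i; have [l lj] := ktree_other j.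
have [z [s zx zy xz _]] := ktree_betweenP (not_eq_sym yx) (not_eq_sym lj).
by exists z; split=> //; [case: s|rewrite xz].
Qed.

(** If the point found is [a], search again between [x] and [a]: a point there sees [y] in the
    direction of [a]. *)
Lemma ktree_between_avoid (a x y : T) i j : x <> y -> i <> j ->
  exists z, [/\ z <> a, sep z x y, k z x = i & k z y = j].
Proof.
move=> xy ij; have [z [s zx zy _ _]] := ktree_betweenP xy ij.
have [za|za] := pselect (z = a); last by exists z.
have zx' : x <> z by case: s.
have [w [s' wx wz _ _]] := ktree_betweenP zx' ij.
exists w; split=> //; first by rewrite -za; case: s'.
  exact: (sep_trans (ktree_pretree kP) s s').
by rewrite (sep_far (ktree_pretree kP) s s').2.
Qed.

End KTree.

(** A map with local action [s] at [a] that preserves all other colors is a color-preserving map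
    from the tree recolored at [a] to the original one. Here [s] is any permutation of the colors,
    in Gamma or not. *)
Definition twist (T I : Type) (a : T) (s : sym I) (k : T -> T -> I) x y : I :=
  if pselect (x = a) then s (k x y) else k x y.

Section Twist.
Variables (T I : Type) (k : T -> T -> I) (a : T) (s : sym I).

Lemma twist_at y : twist a s k a y = s (k a y).
Proof. by rewrite /twist; case: pselect => p. Qed.

Lemma twist_out x y : x <> a -> twist a s k x y = k x y.
Proof. by rewrite /twist; case: pselect => p. Qed.

Lemma twist_eq x y z : twist a s k x y = twist a s k x z <-> k x y = k x z.
Proof.
rewrite /twist; case: pselect => p //; split=> [|->//].
exact: (can_inj (sym_funK s)).
Qed.

Lemma twist_sep z x y : separates (twist a s k) z x y <-> separates k z x y.
Proof.
by split=> -[zx zy d]; split=> // e; apply: d; apply/twist_eq.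
Qed.

(** The first two axioms involve only equality of colors at a point, which recoloring respects. For
    betweenness the witness is chosen different from [a], where nothing has changed. *)
Lemma ktree_twist : (exists i j : I, i <> j) -> ktree k -> ktree (twist a s k).
Proof.
move=> I2 kP; split.
- move=> x y z xz yz d; apply/twist_eq; apply: (ktree_pretree kP) => // e.
  by apply: d; apply/twist_eq.
- move=> x y z xy xz yz /twist_eq e1 /twist_eq e2 /twist_eq e3.
  have [m [s1 s2 s3]] := ktree_median kP xy xz yz e1 e2 e3.
  by exists m; split; apply/twist_sep.
- move=> x y i j xy ij.
  have [z [za [zx zy _] <- <-]] := ktree_between_avoid kP a xy ij.
  by exists z; rewrite !twist_out.
- move=> x i; rewrite /twist; case: pselect => xa.
    have [y yx e] := ktree_color kP x (s^-1 i)%g; exists y => //.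
    by rewrite e; exact: (sym_invK s).
  exact: ktree_color.
Qed.

End Twist.

(** * Homogeneity of colored trees by back-and-forth *)

Section Homogeneity.
Variables (T : eqType) (I : Type).
Hypothesis I2 : exists i j : I, i <> j.
Implicit Types (k : T -> T -> I) (x y z : T) (s : seq (T * T)).

Definition median_closed k (D : seq T) : Prop := forall x y z,
  x \in D -> y \in D -> z \in D -> x <> y -> x <> z -> y <> z ->
  k x y = k x z -> k y x = k y z -> k z x = k z y ->
  exists m, [/\ m \in D, separates k m x y, separates k m x z & separates k m y z].

Definition partial_iso k1 k2 s : Prop :=
  (forall p q, p \in s -> q \in s -> p.1 = q.1 <-> p.2 = q.2) /\
  (forall p q, p \in s -> q \in s -> p.1 <> q.1 -> k1 p.1 q.1 = k2 p.2 q.2).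

(** Closure is asked of the domain only: the image of a median is the median of the images, so the
    range is closed as well, by [closed_iso_swap]. *)
Definition closed_iso k1 k2 s := partial_iso k1 k2 s /\ median_closed k1 (unzip1 s).

Definition swap_pair (p : T * T) := (p.2, p.1).

Lemma mem_swap s p : (swap_pair p \in map swap_pair s) = (p \in s).
Proof. by rewrite mem_map // => -[a b] [c d] [-> ->]. Qed.

Lemma closed_iso_swap k1 k2 s :
  closed_iso k1 k2 s -> closed_iso k2 k1 (map swap_pair s).
Proof.
case=> -[inj kE] cl; split; first split.
- move=> [a b] [c d]; rewrite -[(a, b)]/(swap_pair (b, a)).
  rewrite -[(c, d)]/(swap_pair (d, c)) !mem_swap => m1 m2.
  by have [h1 h2] := inj _ _ m1 m2.
- move=> [a b] [c d]; rewrite -[(a, b)]/(swap_pair (b, a)).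
  rewrite -[(c, d)]/(swap_pair (d, c)) !mem_swap => m1 m2 /= d1.
  by symmetry; apply: (kE _ _ m1 m2) => /(inj _ _ m1 m2).
have sepE p q r : p \in s -> q \in s -> r \in s ->
    separates k1 r.1 p.1 q.1 -> separates k2 r.2 p.2 q.2.
  move=> ps qs rs [d1 d2 d3].
  by split; [move/(inj _ _ rs ps)|move/(inj _ _ rs qs)|rewrite -!kE].
move=> x y z; rewrite /unzip1 -!map_comp.
move=> /mapP[[x0 x1] xs /= ->] /mapP[[y0 y1] ys /= ->] /mapP[[z0 z1] zs /= ->].
move=> xy xz yz e1 e2 e3.
have dxy : x0 <> y0 by move/(inj _ _ xs ys).
have dxz : x0 <> z0 by move/(inj _ _ xs zs).
have dyz : y0 <> z0 by move/(inj _ _ ys zs).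
have kE' a b c d : (a, b) \in s -> (c, d) \in s -> a <> c -> k1 a c = k2 b d.
  by move=> h1 h2; exact: (kE _ _ h1 h2).
have [|||m [/mapP[[m0 m1] ms /= ->]] s1 s2 s3] :=
    cl x0 y0 z0 (map_f fst xs) (map_f fst ys) (map_f fst zs) dxy dxz dyz.
- by rewrite (kE' _ _ _ _ xs ys) ?(kE' _ _ _ _ xs zs).
- by rewrite (kE' _ _ _ _ ys xs) ?(kE' _ _ _ _ ys zs) //; auto.
- by rewrite (kE' _ _ _ _ zs xs) ?(kE' _ _ _ _ zs ys) //; auto.
exists m1; split.
- by apply/mapP; exists (m0, m1).
- exact: (sepE _ _ _ xs ys ms).
- exact: (sepE _ _ _ xs zs ms).
- exact: (sepE _ _ _ ys zs ms).
Qed.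

(* By the last clause [x] separates its gates, so that its position relative
   to [D] is determined by its position relative to them. *)
Definition gates k (D N : seq T) x : Prop :=
  [/\ x \notin D, {subset N <= D},
      forall d, d \in D -> exists2 a, a \in N & d = a \/ k a x <> k a d
    & forall a b, a \in N -> b \in N -> a <> b -> k x a <> k x b].

(** If [x], [d], [e] need a median, then [d] and [e] are in one direction at [x] and hence lie
    behind the same gate [a]. Either [a] is the median, or the median of [a], [d], [e], which is in
    [D], serves for [x] too. *)
Lemma gates_closed k D N x : pretree k -> gates k D N x -> median_closed k D ->
  median_closed k (x :: D).
Proof.
move=> kP [xD ND gN sN] cl.
have xneq d : d \in D -> x <> d by move=> dD xd; rewrite xd dD in xD.
(* the only nontrivial case: the new point with two old ones *)
have main d e : d \in D -> e \in D -> d <> e ->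
    k x d = k x e -> k d x = k d e -> k e x = k e d ->
    exists m, [/\ m \in D, separates k m x d, separates k m x e
                & separates k m d e].
  move=> dD eD de ex ed ee.
  have [a aN ga] := gN d dD; have [b bN gb] := gN e eD.
  have kx u c : u \in D -> c \in N -> u = c \/ k c x <> k c u -> k x u = k x c.
    move=> uD cN [->//|g]; have [->//|uc] := pselect (u = c).
    symmetry; apply: kP g => //; exact: xneq (ND _ cN).
  have ab : a = b.
    apply: contrapT => ab; apply: (sN a b aN bN ab).
    by rewrite -(kx d a) // -(kx e b).
  subst b; have aD := ND _ aN; have xa := xneq _ aD.
  have da : d <> a.
    move=> da; subst d; case: gb => [ea|]; first by apply: de.
    by rewrite ed.
  have ea : e <> a.
    move=> ea; subst e; case: ga => [/da//|]; by rewrite ee.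
  case: ga => // ga; case: gb => // gb.
  have [dea|dea] := pselect (k a d = k a e); last first.
    by exists a; split=> //; split=> //.
  have dE : k d a = k d x by exact: kP.
  have eE : k e a = k e x by exact: kP.
  have [||m [mD [ma md m1] [_ me m2] m3]] :=
    cl a d e aD dD eD (not_eq_sym da) (not_eq_sym ea) de dea.
  - by rewrite dE.
  - by rewrite eE.
  have xm := xneq _ mD; have am : k a m = k a d.
    by exact: kP.
  have mE : k m a = k m x.
    apply: kP => //.
    by rewrite am; apply: contra_not ga => ->.
  by exists m; split=> //; split=> //; rewrite -mE.
have cons3 u v w : (exists m, [/\ m \in D, separates k m u v, separates k m u w
      & separates k m v w]) ->
    exists m, [/\ m \in x :: D, separates k m u v, separates k m u w
      & separates k m v w].
  by case=> m [mD *]; exists m; split=> //; rewrite inE mD orbT.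
move=> u v w; rewrite !inE => /predU1P[->|uD] /predU1P[->|vD] /predU1P[->|wD] //.
- by move=> _ _ vw e1 e2 e3; apply: cons3; exact: main.
- move=> uv uw _ e1 e2 e3; apply: cons3.
  have [m [mD s1 s2 s3]] := main u w uD wD uw e2 e1 (esym e3).
  by exists m; split=> //; exact: sepC.
- move=> uv _ _ e1 e2 e3; apply: cons3.
  have [m [mD s1 s2 s3]] := main u v uD vD uv e3 (esym e1) (esym e2).
  by exists m; split=> //; exact: sepC.
- by move=> uv uw vw e1 e2 e3; apply: cons3; exact: cl.
Qed.

(** A point behind a gate is seen from [x] in the direction of the gate, and sees [x] in that
    direction too. So the colors between [x] and the whole domain are determined by those between
    [x] and its gates, in both trees alike. *)
Lemma gates_ext k1 k2 s N x x' : pretree k1 -> pretree k2 ->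
    closed_iso k1 k2 s -> gates k1 (unzip1 s) N x ->
    (forall p, p \in s -> p.1 \in N ->
      [/\ x' <> p.2, k2 x' p.2 = k1 x p.1 & k2 p.2 x' = k1 p.1 x]) ->
  closed_iso k1 k2 ((x, x') :: s).
Proof.
move=> k1P k2P [[inj kE] cl] gx hN; split; last exact: gates_closed gx cl.
have [xD ND gN _] := gx.
have new p : p \in s ->
    [/\ x <> p.1, x' <> p.2, k2 x' p.2 = k1 x p.1 & k2 p.2 x' = k1 p.1 x].
  move=> ps; have pD := map_f fst ps; have [a aN] := gN _ pD.
  have xneq : x <> p.1 by move=> xp; rewrite xp (map_f fst ps) in xD.
  have /mapP[q qs qE] := ND _ aN; subst a.
  have [x'q e1 e2] := hN q qs aN.
  have [pq|pq] := pselect (p.1 = q.1).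
    by have [/(_ pq) -> _] := inj _ _ ps qs; rewrite pq in xneq *.
  have p2q2 : p.2 <> q.2 by move/(inj _ _ ps qs).
  case=> // d.
  have xq : x <> q.1 by move=> xq; rewrite xq (map_f fst qs) in xD.
  have d2 : k2 q.2 x' <> k2 q.2 p.2.
    by rewrite e2 -(kE _ _ qs ps) //.
  have x'p : x' <> p.2 by move=> e; apply: d2; rewrite e.
  split=> //.
    by rewrite -(k1P _ _ _ xq pq d) -(k2P _ _ _ x'q p2q2 d2).
  rewrite -(k2P _ _ _ p2q2 x'q (not_eq_sym d2)).
  by rewrite -(k1P _ _ _ pq xq (not_eq_sym d)) kE.
split=> p q; rewrite !inE => /predU1P[->|ps] /predU1P[->|qs] //=.
- by have [n1 n2 _ _] := new q qs; split=> // /n1.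
- by have [n1 n2 _ _] := new p ps; split=> /esym // /n1.
- exact: inj.
- by have [_ _ ->] := new q qs.
- by have [_ _ _ ->] := new p ps.
- exact: kE.
Qed.

(** Used with the relation that one point separates [x] from another: a minimal element is then a
    point nearest to [x]. *)
Lemma exists_minimal (D : seq T) (P : T -> Prop) (R : T -> T -> Prop) :
    (forall x, ~ R x x) -> (forall x y z, R x y -> R y z -> R x z) ->
    (exists2 d, d \in D & P d) ->
  exists a, [/\ a \in D, P a & forall e, e \in D -> P e -> ~ R e a].
Proof.
move=> Rirr Rtr; elim: D => [[]//|h D IH] [d].
have [[a [aD Pa mina]] _ _|noD] := pselect (exists a,
    [/\ a \in D, P a & forall e, e \in D -> P e -> ~ R e a]).
  have [[Ph Rha]|hP] := pselect (P h /\ R h a).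
    exists h; split=> //; first by rewrite mem_head.
    move=> e; rewrite inE => /predU1P[-> _|eD Pe Reh]; first exact: Rirr.
    exact: (mina e eD Pe (Rtr _ _ _ Reh Rha)).
  exists a; split=> //; first by rewrite inE aD orbT.
  move=> e; rewrite inE => /predU1P[-> Ph Rha|]; last exact: mina.
  exact: hP.
have noP e : e \in D -> ~ P e by move=> eD Pe; apply: noD; apply: IH; exists e.
rewrite inE => /predU1P[-> Ph|/noP//]; exists h; split=> //.
  by rewrite mem_head.
by move=> e; rewrite inE => /predU1P[->//|/noP//].
Qed.

Section Extension.
Variables (k1 k2 : T -> T -> I) (s : seq (T * T)).
Hypotheses (k1P : ktree k1) (k2P : ktree k2) (sP : closed_iso k1 k2 s).
Local Notation D := (unzip1 s).

Lemma image_unique p q : p \in s -> q \in s -> p.1 = q.1 -> p.2 = q.2.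
Proof. by case: sP => -[inj _] _ ps qs; case: (inj _ _ ps qs). Qed.

(** With a single gate [a] the only data to reproduce are the colors of [x] at [a] and of [a] at
    [x], and [ktree_colors] realizes any two colors. *)
Lemma extend_gate1 x a : gates k1 D [:: a] x ->
  exists x', closed_iso k1 k2 ((x, x') :: s).
Proof.
move=> g; have [xD ND _ _] := g.
have /mapP[p ps pE] := ND a (mem_head _ _).
have [x' [x'p e1 e2]] := ktree_colors k2P I2 p.2 (k1 a x) (k1 x a).
exists x'; apply: (gates_ext (ktree_pretree k1P) (ktree_pretree k2P) sP g).
move=> q qs; rewrite inE => /eqP qa.
by rewrite (@image_unique q p) // qa -?pE.
Qed.

Lemma extend_gate2 x a b : separates k1 x a b -> gates k1 D [:: a; b] x ->
  exists x', closed_iso k1 k2 ((x, x') :: s).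
Proof.
move=> sx g; have [xD ND _ _] := g.
have /mapP[p ps pE] := ND a (mem_head _ _).
have /mapP[q qs qE] : b \in D by apply: ND; rewrite !inE eqxx orbT.
have ab := sep_neq sx; have [xa xb xab] := sx.
have pq : p.1 <> q.1 by rewrite -pE -qE.
have p2q2 : p.2 <> q.2 by case: sP => -[inj _] _ /(inj _ _ ps qs).
have [x' [[x'p x'q _] e1 e2 e3 e4]] := ktree_betweenP k2P p2q2 xab.
exists x'; apply: (gates_ext (ktree_pretree k1P) (ktree_pretree k2P) sP g).
have kE : forall p q, p \in s -> q \in s -> p.1 <> q.1 -> k1 p.1 q.1 = k2 p.2 q.2.
  by case: sP => -[].
have a1 := sep_gate (ktree_pretree k1P) sx.
have b1 := sep_gater (ktree_pretree k1P) sx.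
move=> r rs; rewrite !inE => /orP[/eqP ra|/eqP rb].
  have ->: r.2 = p.2 by apply: image_unique; rewrite // ra.
  by rewrite ra e1 e3 a1 pE qE kE.
have ->: r.2 = q.2 by apply: image_unique; rewrite // rb.
by rewrite rb e2 e4 b1 pE qE kE //; exact: not_eq_sym.
Qed.

(* The gates of [x] are its nearest points in [D]: there are at most two of
   them, and if [x] hangs off the segment between the two then so does their
   median with [x], which is to be added first. *)
Lemma exists_gates x : x \notin D -> D != [::] ->
  (exists a, gates k1 D [:: a] x) \/
  exists a b m, [/\ separates k1 m a b, gates k1 D [:: a; b] m
    & m <> x -> gates k1 (m :: D) [:: m] x].
Proof.
have k1p := ktree_pretree k1P.
move=> xD D0; have xneq d : d \in D -> x <> d.
  by move=> dD xd; rewrite xd dD in xD.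
have irr y : ~ separates k1 y x y by case.
have tr y z w : separates k1 y x z -> separates k1 z x w -> separates k1 y x w.
  by move=> h1 h2; exact: (sep_trans k1p h2 h1).
have [a [aD _ mina0]] : exists a, [/\ a \in D, True
    & forall e, e \in D -> True -> ~ separates k1 e x a].
  apply: exists_minimal => //; case: (D) D0 => // d ? _.
  by exists d => //; rewrite mem_head.
have mina e eD := mina0 e eD Logic.I.
have nosep u d : d \in D -> u \in D ->
    (forall e, e \in D -> ~ separates k1 e x u) -> d <> u -> k1 d x = k1 d u.
  move=> dD uD minu du; apply: contrapT => e; apply: (minu d dD); split=> //.
  exact/not_eq_sym/xneq.
(* If [D] has no point in the direction of [x] at [a], then [a] is the only gate. Otherwise the
   second gate is a nearest point in that direction. *)
have [[d0 d0D [d0a d0E]]|noD2] := pselect (exists2 d, d \in D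
    & d <> a /\ k1 a d = k1 a x); last first.
  left; exists a; split=> //.
  - by move=> d; rewrite inE => /eqP->.
  - move=> d dD; exists a; first by rewrite mem_head.
    have [->|da] := pselect (d = a); first by left.
    by right=> e; apply: noD2; exists d.
  - by move=> u v; rewrite !inE => /eqP-> /eqP->.
have [b [bD [ba bE] minb0]] : exists b, [/\ b \in D,
    b <> a /\ k1 a b = k1 a x
    & forall e, e \in D -> e <> a /\ k1 a e = k1 a x -> ~ separates k1 e x b].
  by apply: exists_minimal => //; exists d0.
(* Minimality in one direction is minimality in all of [D], because a point separating [x] from [b]
   lies in the direction of [x] at [a]. *)
have minb e : e \in D -> ~ separates k1 e x b.
  move=> eD se; have [ex eb eE] := se.
  have ea : e <> a by move=> ea; apply: eE; rewrite ea.
  apply: (minb0 e eD _ se); split=> //; apply: contrapT => d.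
  have d' : k1 a e <> k1 a b by rewrite bE.
  have h1 := k1p _ _ _ ea (xneq _ aD) d.
  have h2 := k1p _ _ _ ea ba d'.
  by apply: eE; rewrite -h1 -h2.
right.
have ab : a <> b by exact: not_eq_sym.
(* Otherwise [a], [b], [d] have a median in [D]. As [a] and [b] are nearest to [x], this median sees
   both of them in the direction of [x], yet it separates them. *)
have gate d : d \in D ->
    d = a \/ d = b \/ k1 a d <> k1 a x \/ k1 b d <> k1 b x.
  move=> dD; apply: contrapT => H.
  have da : d <> a by move=> ?; apply: H; left.
  have db : d <> b by move=> ?; apply: H; right; left.
  have Ea : k1 a d = k1 a x by apply: contrapT => ?; apply: H; do 2 right; left.
  have Eb : k1 b d = k1 b x by apply: contrapT => ?; apply: H; do 3 right.
  have e1 := nosep _ _ bD aD mina ba.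
  have [m [mD [ma mb mab] [_ md mad] [_ _ mbd]]] : exists m, [/\ m \in D,
      separates k1 m a b, separates k1 m a d & separates k1 m b d].
    case: sP => _ cl; apply: cl => //; try exact: not_eq_sym.
    - by rewrite bE Ea.
    - by rewrite -e1 Eb.
    - by rewrite -(nosep _ _ dD aD mina da) -(nosep _ _ dD bD minb db).
  by apply: mab; rewrite -(nosep _ _ mD aD mina ma) -(nosep _ _ mD bD minb mb).
have bE' : k1 b a = k1 b x by rewrite (nosep _ _ bD aD mina ba).
(* [m] is the projection of [x] to the segment from [a] to [b]: [x] itself if it lies in between,
   else the median of the three. *)
have [m [sm am bm mx]] : exists m, [/\ separates k1 m a b, k1 a m = k1 a x,
     k1 b m = k1 b x & m <> x -> k1 m x <> k1 m a /\ k1 m x <> k1 m b].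
  have [xE|xE] := pselect (k1 x a = k1 x b); last first.
    by exists x; split=> //; split=> //; apply: xneq.
  have [||m [s1 s2 s3]] := ktree_median k1P (xneq _ aD) (xneq _ bD) ab xE.
  - by rewrite bE.
  - by rewrite bE'.
  exists m; split=> //.
  - by rewrite (sep_gate k1p s3).
  - by rewrite (sep_gater k1p s3).
  - by move=> _; case: s1 => _ _ ?; case: s2.
have [ma mb mab] := sm.
have mD : m \notin D.
  apply/negP => mD; apply: mab.
  by rewrite -(nosep _ _ mD aD mina ma) -(nosep _ _ mD bD minb mb).
exists a, b, m; split=> //.
  split=> //.
  - by move=> d; rewrite !inE => /orP[] /eqP->.
  - move=> d dD; have [da|[db|[da|db]]] := gate _ dD.
    + by exists a; [rewrite !inE eqxx|left].
    + by exists b; [rewrite !inE eqxx orbT|left].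
    + by exists a; [rewrite !inE eqxx|right; rewrite am; exact: not_eq_sym].
    + by exists b; [rewrite !inE eqxx orbT|right; rewrite bm; exact: not_eq_sym].
  - by move=> u v; rewrite !inE => /orP[]/eqP-> /orP[]/eqP-> // _; exact: not_eq_sym.
move=> mx'; have [xa xb] := mx mx'.
split.
- by rewrite inE negb_or xD andbT; apply/eqP => /esym.
- by move=> d; rewrite !inE => /eqP->; rewrite eqxx.
- move=> d; rewrite inE => /predU1P[->|dD].
    by exists m; [rewrite mem_head|left].
  exists m; first by rewrite mem_head.
  have dm : d <> m by move=> dm; rewrite dm (negbTE mD) in dD.
  right; have [->|[->|[da|db]]] := gate _ dD => //.
    have [->//|da'] := pselect (d = a).
    by rewrite -(k1p m d a) // am; exact: not_eq_sym.
  have [->//|db'] := pselect (d = b).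
  by rewrite -(k1p m d b) // bm; exact: not_eq_sym.
- by move=> u v; rewrite !inE => /eqP-> /eqP->.
Qed.

End Extension.

Lemma extend_iso k1 k2 s x : ktree k1 -> ktree k2 -> closed_iso k1 k2 s ->
    s != [::] ->
  exists s', [/\ closed_iso k1 k2 s', {subset s <= s'} & x \in unzip1 s'].
Proof.
move=> k1P k2P sP s0.
have [xD|xD] := boolP (x \in unzip1 s); first by exists s; split.
have [|[a g]|[a [b [m [sm gm gx]]]]] := exists_gates k1P sP xD.
- by case: (s) s0.
- have [x' sx] := extend_gate1 k1P k2P sP g; exists ((x, x') :: s); split=> //.
    by move=> q qs; rewrite inE qs orbT.
  by rewrite mem_head.
have [m' sm'] := extend_gate2 k1P k2P sP sm gm.
have [mx|/gx {}gx] := pselect (m = x).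
  exists ((m, m') :: s); split=> //; last by rewrite mx mem_head.
  by move=> q qs; rewrite inE qs orbT.
have [x' sx] := extend_gate1 k1P k2P sm' gx.
exists [:: (x, x'), (m, m') & s]; split=> //; last by rewrite mem_head.
by move=> q qs; rewrite !inE qs !orbT.
Qed.

(** The step from stage [i] to the next puts the point of code [i], if there is one, into both
    domain and range. Any two pairs of the union lie in a common stage, so the union is an
    isomorphism. Stages are kept non-empty because a new point is placed relative to its gates. *)
Lemma back_and_forth k1 k2 s : countable [set: T] -> ktree k1 -> ktree k2 ->
    closed_iso k1 k2 s -> s != [::] ->
  exists h : sym T, (forall p, p \in s -> h p.1 = p.2) /\
    forall x y, x <> y -> k2 (h x) (h y) = k1 x y.
Proof.
move=> /countable_injP[code codeI] k1P k2P sP s0.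
pose S := {t | closed_iso k1 k2 t /\ t != [::]}.
have forth (t : S) x : exists t' : S,
    {subset sval t <= sval t'} /\ x \in unzip1 (sval t').
  case: t => t [tP t0] /=.
  have [t' [t'P tt' xt']] := extend_iso x k1P k2P tP t0.
  have t'0 : t' != [::] by case: (t') xt'.
  by exists (exist _ t' (conj t'P t'0)).
have back (t : S) x : exists t' : S,
    {subset sval t <= sval t'} /\ x \in unzip2 (sval t').
  case: t => t [tP t0] /=.
  have t0' : map swap_pair t != [::] by case: (t) t0.
  have [t' [t'P tt' xt']] := extend_iso x k2P k1P (closed_iso_swap tP) t0'.
  have t'0 : map swap_pair t' != [::] by case: (t') xt'.
  exists (exist _ (map swap_pair t') (conj (closed_iso_swap t'P) t'0)); split => /=.
    move=> p; rewrite -(mem_swap t) => /tt'; rewrite -(mem_swap t').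
    by case: p.
  by move: xt'; rewrite /unzip1 /unzip2 -map_comp.
have step (t : S) i : exists t' : S, {subset sval t <= sval t'} /\
    forall x, code x = i -> x \in unzip1 (sval t') /\ x \in unzip2 (sval t').
  have [[x xi]|nox] := pselect (exists x, code x = i); last first.
    by exists t; split=> // x xi; case: nox; exists x.
  have [t1 [tt1 x1]] := forth t x; have [t2 [t12 x2]] := back t1 x.
  exists t2; split=> [p /tt1/t12//|y yi].
  have -> : y = x by apply: codeI; rewrite ?inE // yi.
  split=> //; have /mapP[p pt1 ->] := x1; exact: map_f (t12 _ pt1).
have stepE : forall u : S * nat, exists t' : S, {subset sval u.1 <= sval t'} /\
    forall x, code x = u.2 -> x \in unzip1 (sval t') /\ x \in unzip2 (sval t').
  by case=> t i; exact: step.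
have [next nextP] := choice stepE.
pose S0 : S := exist _ s (conj sP s0).
pose S_ := fix S_ i := if i is j.+1 then next (S_ j, j) else S0.
have S_S i : {subset sval (S_ i) <= sval (S_ i.+1)} by case: (nextP (S_ i, i)).
have S_mono i j : (i <= j)%N -> {subset sval (S_ i) <= sval (S_ j)}.
  move=> /subnK <-; elim: (j - i)%N => [|m IH] //= p /IH; exact: S_S.
have join p q : (exists i, p \in sval (S_ i)) -> (exists i, q \in sval (S_ i)) ->
    (p.1 = q.1 <-> p.2 = q.2) /\ (p.1 <> q.1 -> k1 p.1 q.1 = k2 p.2 q.2).
  move=> [i pi] [j qj].
  have [[[inj kE] _] _] := svalP (S_ (maxn i j)).
  have pm := S_mono _ _ (leq_maxl i j) _ pi.
  have qm := S_mono _ _ (leq_maxr i j) _ qj.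
  by split; [exact: inj|exact: kE].
have fE : forall x, exists y, exists i, (x, y) \in sval (S_ i).
  move=> x; have [_ /(_ x erefl)[/mapP[[a b] ab ->] _]] := nextP (S_ (code x), code x).
  by exists b, (code x).+1.
have gE : forall y, exists x, exists i, (x, y) \in sval (S_ i).
  move=> x; have [_ /(_ x erefl)[_ /mapP[[a b] ab ->]]] := nextP (S_ (code x), code x).
  by exists a, (code x).+1.
have [f fP] := choice fE; have [g gP] := choice gE.
have fK : cancel f g by move=> x; have [/= [_ ->]] := join _ _ (gP (f x)) (fP x).
have gK : cancel g f by move=> x; have [/= [-> ]] := join _ _ (fP (g x)) (gP x).
exists (Sym fK gK); split=> /=.
  move=> p ps; have ip : exists i, p \in sval (S_ i) by exists 0%N.
  by have [/= [-> ]] := join _ _ (fP p.1) ip.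
by move=> x y xy; have [/= _ ->] := join _ _ (fP x) (fP y).
Qed.

(** Recolor the source at [x] by [s] and at [y] by [t]; then a color-preserving map is wanted. The
    starting domain has two points, hence no three distinct ones, and is median-closed for that
    reason. *)
Lemma ktree_two_point k (s t : sym I) x y x' y' : countable [set: T] -> ktree k ->
    x <> y -> x' <> y' -> k x' y' = s (k x y) -> k y' x' = t (k y x) ->
  exists h : sym T, [/\ h x = x', h y = y',
    forall u, u <> x -> k x' (h u) = s (k x u),
    forall u, u <> y -> k y' (h u) = t (k y u) &
    forall u v, u <> x -> u <> y -> u <> v -> k (h u) (h v) = k u v].
Proof.
move=> cT kP xy xy' e1 e2.
pose k1 := twist x s (twist y t k).
have k1P : ktree k1 by do 2 apply: ktree_twist => //.
have k1x u : k1 x u = s (k x u) by rewrite /k1 twist_at twist_out.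
have k1y u : k1 y u = t (k y u).
  by rewrite /k1 twist_out ?twist_at //; exact: not_eq_sym.
have k1u u v : u <> x -> u <> y -> k1 u v = k u v.
  by move=> ux uy; rewrite /k1 !twist_out.
have sP : closed_iso k1 k [:: (x, x'); (y, y')].
  split; first split.
  - move=> p q; rewrite !inE => /orP[]/eqP-> /orP[]/eqP-> //=.
    by split=> /esym.
  - move=> p q; rewrite !inE => /orP[]/eqP-> /orP[]/eqP-> //= _.
      by rewrite k1x.
    by rewrite k1y.
  - move=> a b c; rewrite /= !inE => /orP[]/eqP-> /orP[]/eqP-> // /orP[]/eqP-> //.
have [h [hs hE]] := back_and_forth cT k1P kP sP isT.
have hx : h x = x' by exact: (hs _ (mem_head _ _)).
have hy : h y = y' by apply: (hs (y, y')); rewrite !inE eqxx orbT.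
exists h; split=> //.
- by move=> u ux; rewrite -hx hE ?k1x //; exact: not_eq_sym.
- by move=> u uy; rewrite -hy hE ?k1y //; exact: not_eq_sym.
- by move=> u v ux uy uv; rewrite hE ?k1u.
Qed.

End Homogeneity.

(** * Automorphisms of colored trees *)

Lemma subgroupP (gT : groupType) (G : set gT) : subgroup G <->
  [/\ G 1%g, forall x y, G x -> G y -> G (x * y)%g & forall x, G x -> G x^-1%g].
Proof.
split=> [GP|[G1 GM GV]]; last first.
  split; first by rewrite inE.
  by move=> x y; rewrite !inE => Gx Gy; apply: GM => //; exact: GV.
have [G1 _] := GP; split; first by move: G1; rewrite inE.
- by move=> x y Gx Gy; have := group_closedM GP (x := x) (y := y); rewrite !inE; exact.
- by move=> x Gx; have := group_closedV GP (x := x); rewrite !inE; exact.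
Qed.

Lemma symVK (T : Type) (g : sym T) x : (g^-1)%g (g x) = x.
Proof. exact: (sym_funK g). Qed.

Lemma symKV (T : Type) (g : sym T) x : g ((g^-1)%g x) = x.
Proof. exact: (sym_invK g). Qed.

Lemma sym_injective (T : Type) (g : sym T) : injective g.
Proof. exact: can_inj (sym_funK g). Qed.

Lemma sym_neq (T : Type) (g : sym T) x y : x <> y -> g x <> g y.
Proof. by move=> xy e; apply: xy; exact: (sym_injective e). Qed.

Lemma restrict_sym (S : Type) (Y : set S) (g : sym S) :
  (forall y, Y (g y) <-> Y y) -> exists p : sym Y, forall y : Y, val (p y) = g (val y).
Proof.
move=> gY.
have gY1 (y : Y) : g (val y) \in Y by rewrite inE; apply/gY; exact: set_valP.
have gY2 (y : Y) : (g^-1)%g (val y) \in Y.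
  by rewrite inE; apply/gY; rewrite symKV; exact: set_valP.
pose f (y : Y) : Y := SigSub (gY1 y).
pose f' (y : Y) : Y := SigSub (gY2 y).
have fK : cancel f f' by move=> y; apply: val_inj; exact: (sym_funK g).
have f'K : cancel f' f by move=> y; apply: val_inj; exact: (sym_invK g).
by exists (Sym fK f'K).
Qed.

Section Automorphisms.
Variables (T : eqType) (I : Type) (k : T -> T -> I) (Gamma : set (sym I)).
Hypotheses (kP : ktree k) (cT : countable [set: T]) (GammaP : subgroup Gamma).
Hypothesis T0 : [set: T] !=set0.
Hypothesis I3 : exists a b c : I, [/\ a <> b, a <> c & b <> c].
Implicit Types (x y z a r : T) (i j l : I) (g h f : sym T) (s t : sym I).

Let kp := ktree_pretree kP.

Let I2 : exists i j : I, i <> j.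
Proof. by have [a [b [_ [ab _ _]]]] := I3; exists a, b. Qed.

Lemma third_color i j : exists l, l <> i /\ l <> j.
Proof.
have [a [b [c [ab ac bc]]]] := I3; apply: contrapT => H.
have H' e : e = i \/ e = j.
  apply: contrapT => he; apply: H; exists e.
  by split=> ee; apply: he; [left|right].
by case: (H' a) => ?; case: (H' b) => ?; case: (H' c) => ?; congruence.
Qed.

Definition aut : set (sym T) := [set g | forall x,
  exists2 s, Gamma s & forall y, y <> x -> k (g x) (g y) = s (k x y)].

Definition half a i : set T := [set y | y <> a /\ k a y = i].

Definition rist a i : set (sym T) :=
  [set g | aut g /\ forall y, ~ half a i y -> g y = y].

(** The group for trivial local action, contained in [aut] whatever Gamma is. Conjugation by such a
    map moves half-trees without changing their color. *)
Definition colored_iso g := forall x y, x <> y -> k (g x) (g y) = k x y.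

Let Gamma1 : Gamma 1%g. Proof. by case/subgroupP: GammaP. Qed.

Lemma aut_subgroup : subgroup aut.
Proof.
have [_ GM GV] := (subgroupP Gamma).1 GammaP; apply/subgroupP; split.
- by move=> x; exists 1%g.
- move=> g h gP hP x; have [s Gs sE] := hP x; have [t Gt tE] := gP (h x).
  exists (t * s)%g; first exact: GM.
  by move=> y yx; rewrite !sym_mulE tE ?sE //; exact: sym_neq.
- move=> g gP x; have [s Gs sE] := gP ((g^-1)%g x).
  exists (s^-1)%g; first exact: GV.
  move=> y yx; have := sE ((g^-1)%g y); rewrite !symKV => -> //.
    by rewrite symVK.
  exact: sym_neq.
Qed.

Lemma aut1 : aut 1%g. Proof. by case/subgroupP: aut_subgroup. Qed.
Lemma autM g h : aut g -> aut h -> aut (g * h)%g.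
Proof. by case/subgroupP: aut_subgroup => _ + _; apply. Qed.
Lemma autV g : aut g -> aut (g^-1)%g.
Proof. by case/subgroupP: aut_subgroup => _ _; apply. Qed.

Lemma colored_iso_aut g : colored_iso g -> aut g.
Proof. by move=> gP x; exists 1%g => // y yx; rewrite gP. Qed.

Lemma colored_isoV g : colored_iso g -> colored_iso (g^-1)%g.
Proof. by move=> gP x y xy; rewrite -gP ?symKV //; exact: sym_neq. Qed.

Lemma colored_isoM g h : colored_iso g -> colored_iso h -> colored_iso (g * h)%g.
Proof. by move=> gP hP x y xy; rewrite !sym_mulE gP ?hP //; exact: sym_neq. Qed.

Lemma colored_iso_two x y x' y' : x <> y -> x' <> y' ->
    k x' y' = k x y -> k y' x' = k y x ->
  exists h, [/\ colored_iso h, h x = x' & h y = y'].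
Proof.
move=> xy xy' e1 e2.
have [h [hx hy h1 h2 h3]] :=
  ktree_two_point I2 (s := 1%g) (t := 1%g) cT kP xy xy' e1 e2.
exists h; split=> // u v uv.
have [ux|ux] := pselect (u = x); first by subst u; rewrite hx h1.
have [uy|uy] := pselect (u = y); first by subst u; rewrite hy h2.
exact: h3.
Qed.

Lemma half_root a i y z : half a i y -> ~ half a i z -> k y z = k y a.
Proof.
move=> [ya yi] hz; have [->//|za] := pselect (z = a).
by symmetry; apply: kp => //; rewrite yi => e; apply: hz; split.
Qed.

Lemma half_from a i x y : x <> a -> k a x <> i -> half a i y -> k x y = k x a.
Proof. by move=> xa xi [ya yi]; symmetry; apply: kp => //; rewrite yi. Qed.

Lemma half_outside a i x y z : ~ half a i x -> half a i y -> half a i z ->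
  k x y = k x z.
Proof.
move=> hx hy hz; have [xa|xa] := pselect (x = a).
  by rewrite xa; case: hy => _ ->; case: hz.
have xi : k a x <> i by move=> xi; apply: hx.
by rewrite (half_from xa xi hy) (half_from xa xi hz).
Qed.

Lemma half_sub a i r : r <> a -> k a r <> i -> half a i `<=` half r (k r a).
Proof.
move=> ra ri y ya; split; first by move=> yr; apply: ri; rewrite -yr; case: ya.
exact: half_from ya.
Qed.

Lemma rist_stable a i g y : rist a i g -> half a i y -> half a i (g y).
Proof.
move=> [_ gP] h; apply: contrapT => h'.
by have e := sym_injective (gP _ h'); apply: h'; rewrite e.
Qed.

Lemma rist_outside a i g x y : rist a i g -> ~ half a i x -> y <> x ->
  k x (g y) = k x y.
Proof.
move=> gP hx yx; have [hy|hy] := pselect (half a i y).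
  by exact: (half_outside hx (rist_stable gP hy) hy).
by rewrite (proj2 gP).
Qed.

Lemma ristV a i g : rist a i g -> rist a i (g^-1)%g.
Proof.
move=> gP; have [gA gE] := gP; split; first exact: autV.
by move=> y hy; rewrite -{1}(gE _ hy) symVK.
Qed.

Lemma ristM a i g h : rist a i g -> rist a i h -> rist a i (g * h)%g.
Proof.
move=> [gA gE] [hA hE]; split; first exact: autM.
by move=> y hy; rewrite sym_mulE hE // gE.
Qed.

Lemma rist1 a i : rist a i 1%g.
Proof. by split=> //; exact: aut1. Qed.

Lemma rist_sub a i b j : half a i `<=` half b j -> rist a i `<=` rist b j.
Proof. by move=> ab g [gA gE]; split=> // y hy; apply: gE => /ab. Qed.

Lemma rist_conj a i g h s : aut h -> (forall y, y <> a -> k (h a) (h y) = s (k a y)) ->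
  rist a i g -> rist (h a) (s i) (h * g * h^-1)%g.
Proof.
move=> hA sE [gA gE]; split; first by apply: autM; [exact: autM|exact: autV].
move=> y hy; rewrite !sym_mulE gE ?symKV // => -[ya yi]; apply: hy; split.
  by move=> e; apply: ya; rewrite e symVK.
by rewrite -yi -sE // symKV.
Qed.

(** On the half-tree of color [i] use [u i], which takes it onto that of color [s i]. A point of a
    half-tree sees everything outside in the direction of [x], so its local action is that of [u i].
    Hence [u i] is constrained only on its own half-tree and may lie outside [aut]. *)
Lemma star_glue x s (u : I -> sym T) : Gamma s -> (forall i, u i x = x) ->
    (forall i y, y <> x -> k x (u i y) = s i <-> k x y = i) ->
    (forall i y, half x i y -> exists2 t, Gamma t &
       forall z, z <> y -> k (u i y) (u i z) = t (k y z)) ->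
  exists F, [/\ aut F, F x = x, forall y, y <> x -> F y = u (k x y) y
    & forall y, y <> x -> k x (F y) = s (k x y)].
Proof.
move=> Gs ux uk uloc.
pose f y := if pselect (y = x) then x else u (k x y) y.
pose f' y := if pselect (y = x) then x else ((u ((s^-1)%g (k x y)))^-1)%g y.
have fx : f x = x by rewrite /f; case: pselect.
have f'x : f' x = x by rewrite /f'; case: pselect.
have fE y : y <> x -> f y = u (k x y) y by rewrite /f; case: pselect.
have f'E y : y <> x -> f' y = ((u ((s^-1)%g (k x y)))^-1)%g y.
  by rewrite /f'; case: pselect.
have uxn i y : y <> x -> u i y <> x by rewrite -{2}(ux i); exact: sym_neq.
have kf y : y <> x -> k x (f y) = s (k x y).
  by move=> yx; rewrite fE //; apply/uk.
have fK : cancel f f'.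
  move=> y; have [->|yx] := pselect (y = x); first by rewrite fx f'x.
  rewrite f'E; last by rewrite fE //; exact: uxn.
  by rewrite kf // symVK fE // symVK.
have f'K : cancel f' f.
  move=> y; have [->|yx] := pselect (y = x); first by rewrite f'x fx.
  set i := (s^-1)%g (k x y).
  have nx : ((u i)^-1)%g y <> x.
    by move=> e; apply: yx; rewrite -(symKV (u i) y) e ux.
  have ki : k x (((u i)^-1)%g y) = i.
    by apply/(uk i _ nx); rewrite symKV /i symKV.
  by rewrite f'E // -/i fE // ki symKV.
exists (Sym fK f'K); split=> //= y.
have [->|yx] := pselect (y = x).
  by exists s => // z zx /=; rewrite fx kf.
have hy : half x (k x y) y by [].
have [t Gt tE] := uloc _ _ hy; exists t => // z zy /=.
have [zx|zx] := pselect (half x (k x y) z).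
  by case: zx => zx zi; rewrite !fE // zi tE.
rewrite (half_root hy zx).
have hfy : half x (s (k x y)) (f y) by split; [rewrite fE //; exact: uxn|exact: kf].
rewrite (half_root hfy).
  by rewrite fE // -{2}(ux (k x y)) tE.
move=> [fzx kz]; apply: zx; have zx : z <> x by move=> zx; rewrite zx fx in fzx.
by split=> //; apply: (@sym_injective _ s); rewrite -kf.
Qed.

(** Restriction of [u] to one half-tree: glue it with the identity on all the others. *)
Lemma cut a i (u : sym T) : u a = a ->
    (forall y, y <> a -> k a (u y) = i <-> k a y = i) ->
    (forall y, half a i y -> exists2 t, Gamma t &
       forall z, z <> y -> k (u y) (u z) = t (k y z)) ->
  exists2 F, rist a i F & forall y, half a i y -> F y = u y.
Proof.
move=> ua uk uloc.
pose w j := if pselect (j = i) then u else 1%g.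
have wi : w i = u by rewrite /w; case: pselect.
have wj j : j <> i -> w j = 1%g by rewrite /w; case: pselect.
have [||||F [FA Fa FE _]] := @star_glue a 1%g w.
- exact: Gamma1.
- by move=> j; have [->|/wj->//] := pselect (j = i); rewrite wi.
- move=> j y ya; have [->|/wj->//] := pselect (j = i).
  by rewrite wi; exact: uk.
- move=> j y hy; have [ji|/wj->] := pselect (j = i); last by exists 1%g.
  by rewrite ji wi; apply: uloc; rewrite -ji.
exists F; last by move=> y [ya yi]; rewrite FE // yi wi.
split=> // y hy; have [->//|ya] := pselect (y = a).
by rewrite FE // wj // => yi; apply: hy.
Qed.

(** A product over an arbitrary index type. Inside a half-tree the local action is that of its own
    factor; at a point outside all of them it is trivial, since each half-tree lies in a single
    direction there and is preserved. *)
Lemma disjoint_glue (J : Type) (a : J -> T) (i : J -> I) (f : J -> sym T) :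
    (forall p q y, half (a p) (i p) y -> half (a q) (i q) y -> p = q) ->
    (forall p, rist (a p) (i p) (f p)) ->
  exists F, [/\ aut F, forall p y, half (a p) (i p) y -> F y = f p y
    & forall y, (forall p, ~ half (a p) (i p) y) -> F y = y].
Proof.
move=> disj fR.
have mk (h : J -> sym T) : exists F, (forall p y, half (a p) (i p) y -> F y = h p y)
    /\ forall y, (forall p, ~ half (a p) (i p) y) -> F y = y.
  have /choice[F FP] : forall y, exists z,
      (forall p, half (a p) (i p) y -> z = h p y) /\
      ((forall p, ~ half (a p) (i p) y) -> z = y).
    move=> y; have [[p hp]|np] := pselect (exists p, half (a p) (i p) y).
      exists (h p y); split=> [q hq|/(_ p)//].
      by rewrite (disj _ _ _ hp hq).
    by exists y; split=> // p hp; case: np; exists p.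
  by exists F; split=> [p y|y]; case: (FP y) => [h1 h2]; [exact: h1|exact: h2].
have cancel_glue (h h' : J -> sym T) F F' :
    (forall p, rist (a p) (i p) (h p)) -> (forall p y, h' p (h p y) = y) ->
    (forall p y, half (a p) (i p) y -> F y = h p y) ->
    (forall y, (forall p, ~ half (a p) (i p) y) -> F y = y) ->
    (forall p y, half (a p) (i p) y -> F' y = h' p y) ->
    (forall y, (forall p, ~ half (a p) (i p) y) -> F' y = y) -> cancel F F'.
  move=> hR hK F1 F2 F'1 F'2 y.
  have [[p hp]|np] := pselect (exists p, half (a p) (i p) y).
    rewrite (F1 p) // (F'1 p) //; exact: rist_stable (hR p) hp.
  have np' p : ~ half (a p) (i p) y by move=> hp; apply: np; exists p.
  by rewrite F2 // F'2.
have [F [F1 F2]] := mk f; have [F' [F'1 F'2]] := mk (fun p => (f p)^-1)%g.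
have FK : cancel F F'.
  by apply: (cancel_glue f (fun p => (f p)^-1)%g) => // p y; rewrite symVK.
have F'K : cancel F' F.
  apply: (cancel_glue (fun p => (f p)^-1)%g f) => // p; first exact: ristV.
  by move=> y; rewrite symKV.
exists (Sym FK F'K); split=> //= y.
have Fh p z : half (a p) (i p) (F z) <-> half (a p) (i p) z.
  split=> h; last by rewrite (F1 p) //; exact: rist_stable (fR p) h.
  rewrite -(FK z) (F'1 p) //.
  exact: rist_stable (ristV (fR p)) h.
have [[p hp]|np] := pselect (exists p, half (a p) (i p) y); last first.
  have np' p : ~ half (a p) (i p) y by move=> hp; apply: np; exists p.
  exists 1%g => // z zy /=; rewrite F2 //.
  have [[p hp]|nq] := pselect (exists p, half (a p) (i p) z).
    by rewrite (F1 p) //; exact: rist_outside (fR p) (np' p) zy.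
  by rewrite F2 // => p hp; apply: nq; exists p.
have [fA fE] := fR p; have [t Gt tE] := fA y; exists t => // z zy /=.
have hfy : half (a p) (i p) (F y) by exact/Fh.
have [hz|hz] := pselect (half (a p) (i p) z).
  by rewrite !(F1 p) ?tE.
have ya : a p <> y by move=> ya; case: hp; rewrite ya.
rewrite (half_root hp hz) (half_root hfy) ?Fh //.
by rewrite (F1 p) // -{1}(fE (a p)) ?tE // => -[].
Qed.

Lemma colored_isoX h n : colored_iso h -> colored_iso (h ^+ n)%g.
Proof.
move=> hP; elim: n => [|n IH]; first by move=> x y.
by rewrite expgS; exact: colored_isoM.
Qed.

Lemma colored_iso_half h a i y : colored_iso h -> half a i y -> half (h a) i (h y).
Proof.
by move=> hP [ya yi]; split; [exact: sym_neq|rewrite hP //; exact: not_eq_sym].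
Qed.

(* An infinite swindle. Some [h] fixing [r] translates [a] away from [r] along
   a ray, so that the sets [half (h^n a) i] are disjoint, and the product [F]
   of the conjugates [h^n f h^-n] satisfies [F = h F h^-1 f]. *)
Lemma rist_commutator a i : exists r j, half a i `<=` half r j /\
  forall f, rist a i f ->
    exists t F : sym T, [/\ rist r j t, rist r j F & f = [~ t^-1, F]%g].
Proof.
(* [l] is the direction back to [r] and [j] the direction of the ray. Both [a] and [b] see [r] in
   color [l], so that some [h] takes the pair [r], [a] to [r], [b]. As [i] differs from [j] and [l],
   the translates of [half a i] hang off the ray and are disjoint. *)
have [l [li _]] := third_color i i; have [j [ji jl]] := third_color i l.
have [r [ra kar _]] := ktree_colors kP I2 a l i.
have [b [ba kab kba]] := ktree_colors kP I2 a j l.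
have rb : r <> b by move=> rb; apply: jl; rewrite -kab -rb.
have d : k a r <> k a b by rewrite kar kab; exact: not_eq_sym.
have krb : k r b = k r a by symmetry; apply: kp.
have kbr : k b r = k b a by symmetry; apply: kp => //; exact: not_eq_sym.
have [h [hP hr ha]] : exists h, [/\ colored_iso h, h r = r & h a = b].
  by apply: colored_iso_two => //; rewrite kbr kba kar.
pose a_ n := (h ^+ n)%g a.
have aS n : a_ n.+1 = h (a_ n) by rewrite /a_ expgS.
have aD m n : (h ^+ m)%g (a_ n) = a_ (m + n)%N by rewrite /a_ expgnDr.
have hX n := colored_isoX n hP.
have ray n : [/\ a <> a_ n.+1, k a (a_ n.+1) = j & k (a_ n.+1) a = l].
  elim: n => [|n [an kan kna]].
    by rewrite aS /a_ expg0 /= ha; split=> //; exact: not_eq_sym.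
  have E : k b (a_ n.+2) = j by rewrite -ha aS hP.
  have bn : b <> a_ n.+2 by rewrite -ha aS; exact: sym_neq.
  have an2 : a <> a_ n.+2 by move=> e; apply: jl; rewrite -E -e.
  have dn : k b a <> k b (a_ n.+2) by rewrite E kba; exact: not_eq_sym.
  split=> //.
    by rewrite -kab; symmetry; apply: kp => //; exact: not_eq_sym.
  have -> : k (a_ n.+2) a = k (a_ n.+2) b.
    by symmetry; apply: kp => //; exact: not_eq_sym.
  by rewrite aS -ha hP //; exact: not_eq_sym.
have kaa m n : (m < n)%N -> [/\ a_ m <> a_ n, k (a_ m) (a_ n) = j & k (a_ n) (a_ m) = l].
  move=> /subnK; rewrite addnS -addSn addnC => <-.
  have [e1 e2 e3] := ray (n - m.+1)%N.
  have -> : a_ m = (h ^+ m)%g a by [].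
  by rewrite -aD !hX //; split=> //; exact: sym_neq.
have disj m n y : half (a_ m) i y -> half (a_ n) i y -> m = n.
  have lt p q : (p < q)%N -> half (a_ p) i y -> ~ half (a_ q) i y.
    move=> pq hp hq; have [e1 e2 e3] := kaa _ _ pq.
    have [hpy ipy] := hp; apply: (ji); rewrite -e2 -ipy.
    symmetry; apply: (half_from _ _ hq) => //; rewrite e3 //; exact: not_eq_sym.
  by case: (ltngtP m n) => // mn hm hn; [case: (lt m n)|case: (lt n m)].
have hrX n : (h ^+ n)%g r = r by elim: n => // n IH; rewrite expgS sym_mulE IH.
have an_r n : r <> a_ n by rewrite -(hrX n); exact: sym_neq.
have kan_r n : k (a_ n) r = l.
  by rewrite -{1}(hrX n) hX //; exact: not_eq_sym.
have kr_an n : k r (a_ n) = k r a by rewrite -{1}(hrX n) hX.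
have sub n : half (a_ n) i `<=` half r (k r a).
  rewrite -(kr_an n); apply: half_sub => //; rewrite kan_r //.
exists r, (k r a); split=> [|f fR]; first exact: (sub 0%N).
pose f_ n := (h ^+ n * f * (h ^+ n)^-1)%g.
have fnR n : rist (a_ n) i (f_ n).
  apply: (@rist_conj a i f (h ^+ n)%g 1%g) => //.
    exact: colored_iso_aut (hX n).
  by move=> y ya; rewrite hX //; exact: not_eq_sym.
have [F [FA FE F0]] := disjoint_glue disj fnR.
have FR : rist r (k r a) F.
  by split=> // y hy; apply: F0 => n /sub.
(* [h] also moves points outside the half-tree at [r]. Its restriction [t] conjugates [F] in the
   same way, as [F] is supported inside. *)
have [t tR tE] : exists2 t : sym T, rist r (k r a) t
    & forall y, half r (k r a) y -> t y = h y.
  apply: cut => // [y yr|y _]; last exact: colored_iso_aut.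
  by rewrite -{1}hr hP //; exact: not_eq_sym.
have tF : (t * F = h * F * h^-1 * t)%g.
  apply: symP => y; rewrite !sym_mulE.
  have [hy|hy] := pselect (half r (k r a) y).
    by rewrite (tE y) // symVK tE //; exact: rist_stable FR hy.
  rewrite (proj2 FR) // (proj2 tR) // (proj2 FR) ?symKV //.
  by move=> hy'; apply: hy; have := colored_iso_half hP hy'; rewrite hr symKV.
exists t, F; split=> //.
(* Conjugation by [h] shifts the factors of [F] one step along the ray, and [f] refills the vacant
   place 0. *)
have EF : (F = h * F * h^-1 * f)%g.
  apply: symP => y; rewrite !sym_mulE.
  have shift n z : half (a_ n.+1) i z -> half (a_ n) i ((h^-1)%g z).
    move=> hz; rewrite -[a_ n](symVK h) -aS.
    exact: colored_iso_half (colored_isoV hP) hz.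
  have unshift n z : half (a_ n) i ((h^-1)%g z) -> half (a_ n.+1) i z.
    by move=> /(colored_iso_half hP); rewrite symKV -aS.
  have fE z : ~ half a i z -> f z = z by case: fR => _; exact.
  have [[[|n] hn]|none] := pselect (exists n, half (a_ n) i y).
  - have hf : half (a_ 0) i (f y) by exact: rist_stable fR hn.
    rewrite (F0 ((h^-1)%g (f y))) ?symKV; last first.
      by move=> m /unshift /(disj _ _ _ hf).
    by rewrite (FE 0%N) // /f_ expg0 mul1g invg1 mulg1.
  - rewrite fE; last by move=> h0; have := disj 0%N n.+1 y h0 hn.
    rewrite (FE n.+1) // (FE n); last exact: shift.
    by rewrite /f_ expgS invgM !sym_mulE.
  - rewrite fE; last by move=> h0; apply: none; exists 0%N.
    rewrite (F0 y); last by move=> n hn; apply: none; exists n.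
    rewrite F0 ?symKV // => n /unshift hn; apply: none; by exists n.+1.
rewrite commgEl conjgE invgK.
have -> : (t * (F^-1 * (t^-1 * F)) = (t * F^-1 * t^-1) * F)%g by rewrite !mulgA.
have -> : (t * F^-1 * t^-1 = (h * F * h^-1)^-1)%g.
  have <- : (t * F * t^-1 = h * F * h^-1)%g by rewrite tF mulgK.
  by rewrite !invgM invgK mulgA.
by apply: (mulgI (h * F * h^-1)%g); rewrite mulVKg -EF.
Qed.

(** Put [a = g^-1 b]. The two color equations allow a map [h0] that fixes [r], takes [a] to [b] and
    has at [a] the local action of [g]. It is then corrected to agree with [g] on a half-tree at [a]
    pointing away from [r], and cut down to the half-tree at [r] containing [a] and [b]. *)
Lemma rist_patch g r b : aut g -> b <> r -> b <> g r -> g^-1%g b <> r ->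
    k r (g^-1%g b) = k r b -> k b r = k b (g r) ->
  exists a i, exists2 h, rist r (k r b) h & half a i !=set0 /\
    forall y, half a i y -> h y = g y.
Proof.
move=> gA br bgr ar kr kb.
set a := (g^-1)%g b in ar kr.
have ga : g a = b by rewrite /a symKV.
have [t Gt tE] := gA a; rewrite ga in tE.
have ra : r <> a by exact: not_eq_sym.
have rb : r <> b by exact: not_eq_sym.
have [h0 [h0r h0a h1 h2 h3]] : exists h, [/\ h r = r, h a = b,
    forall u, u <> r -> k r (h u) = k r u,
    forall u, u <> a -> k b (h u) = t (k a u) &
    forall u v, u <> r -> u <> a -> u <> v -> k (h u) (h v) = k u v].
  apply: (ktree_two_point I2 (s := 1%g) (t := t) cT kP ra rb).
    by rewrite kr.
  by rewrite -tE.
have h0A : aut h0.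
  move=> u; have [->|ur] := pselect (u = r).
    by exists 1%g => // y yr; rewrite h0r h1.
  have [->|ua] := pselect (u = a); first by exists t => // y ya; rewrite h0a h2.
  by exists 1%g => // y yu; rewrite h3 //; exact: not_eq_sym.
have [i [ir _]] := third_color (k a r) (k a r).
(* [h0^-1 g] fixes [a] with trivial local action there, so it preserves [half a i] and can be
   restricted to it. *)
have [c cR cE] : exists2 c : sym T, rist a i c
    & forall y, half a i y -> c y = (h0^-1 * g)%g y.
  apply: cut => [|y ya|y _]; first by rewrite sym_mulE ga -h0a symVK.
    rewrite sym_mulE; suff -> : k a ((h0^-1)%g (g y)) = k a y by [].
    apply: (@sym_injective _ t); rewrite -h2 ?symKV ?tE //.
    by move=> e; apply: ya; apply: (@sym_injective _ g); rewrite ga -h0a -e symKV.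
  by apply: autM => //; exact: autV.
have nr : ~ half a i r by case=> _ /esym.
have [h hR hE] : exists2 h : sym T, rist r (k r b) h
    & forall y, half r (k r b) y -> h y = (h0 * c)%g y.
  apply: cut => [|y yr|y _]; first by rewrite sym_mulE (proj2 cR).
    rewrite sym_mulE h1 ?(rist_outside cR) //.
    by rewrite -{1}(proj2 cR r nr); exact: sym_neq.
  by apply: autM => //; case: cR.
exists a, i, h => //; split.
  by have [y ya yi] := ktree_color kP a i; exists y.
move=> y hy; rewrite hE.
  by rewrite sym_mulE cE // sym_mulE symKV.
by rewrite -kr; apply: half_sub hy => //; exact: not_eq_sym.
Qed.

Lemma aut_rist_product g : aut g -> exists a i b j f h,
  [/\ rist a i f, rist b j h & g = (f * h)%g].
Proof.
move=> gA; have [a [_ [_ _]]] := I3.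
have [[r gr]|g1] := pselect (exists r, g r <> r); last first.
  have [x _] := T0; exists x, a, x, a, 1%g, 1%g; split; try exact: rist1.
  rewrite mul1g; apply: symP => y /=; apply: contrapT => yg; apply: g1.
  by exists y.
have [b [br bgr ar [kr kb]]] : exists b, [/\ b <> r, b <> g r, g^-1%g b <> r
    & k r (g^-1%g b) = k r b /\ k b r = k b (g r)].
  have [s Gs sE] := gA r.
  have rgr : r <> g r by exact: not_eq_sym.
  (* That [g^-1 b] lies in the direction of [b] at [r] is rewritten, through the local action [s] at
     [r], as a condition on the color of [b] at [g r]. *)
  suff [b [br bgr rb grb kb]] : exists b, [/\ b <> r, b <> g r, k r b = k r (g r),
      k (g r) b = s (k r (g r)) & k b r = k b (g r)].
    have ar : (g^-1)%g b <> r.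
      by move=> e; apply: bgr; rewrite -e symKV.
    exists b; split=> //; split=> //; apply: (@sym_injective _ s).
    by rewrite -sE // symKV rb.
  (* If the required direction at [g r] leads away from [r], any point in it will do. If it is the
     direction of [r], take [b] on a side branch, in a third color at a point between [r] and
     [g r]. *)
  have [e|e] := pselect (s (k r (g r)) = k (g r) r); last first.
    have [b bgr kb] := ktree_color kP (g r) (s (k r (g r))).
    have br : b <> r by move=> e'; apply: e; rewrite -kb e'.
    have d : k (g r) b <> k (g r) r by rewrite kb.
    exists b; split=> //; symmetry; first by apply: kp => //; exact: not_eq_sym.
    exact: kp.
  have [p [q [l [pq pl ql]]]] := I3.
  have [z [[zr zgr _] zp zq rz grz]] := ktree_betweenP kP rgr pq.
  have [b bz kb] := ktree_color kP z l.
  have br : b <> r by move=> e'; apply: pl; rewrite -kb e' zp.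
  have bgr : b <> g r by move=> e'; apply: ql; rewrite -kb e' zq.
  have d1 : k z r <> k z b by rewrite zp kb.
  have d2 : k z (g r) <> k z b by rewrite zq kb.
  have E1 : k b z = k b r by apply: kp => //; exact: not_eq_sym.
  have E2 : k b z = k b (g r) by apply: kp => //; exact: not_eq_sym.
  have E3 : k r z = k r b by apply: kp => //; exact: not_eq_sym.
  have E4 : k (g r) z = k (g r) b by apply: kp => //; exact: not_eq_sym.
  by exists b; split=> //; [rewrite -E3|rewrite -E4 grz|rewrite -E1].
have [c [i [h hR [[w wc] hE]]]] := rist_patch gA br bgr ar kr kb.
(* [h^-1 g] is trivial on [half c i]. From a point [w] of it, everything outside is seen in the
   direction of [c], so the support lies in one half-tree at [w]. *)
exists r, (k r b), w, (k w c), h, (h^-1 * g)%g; split=> //; last by rewrite mulVKg.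
split; first by apply: autM => //; apply: autV; case: hR.
move=> y hy; rewrite sym_mulE -hE ?symVK //.
have [wc' wi] := wc; split.
  by move=> yc; apply: hy; rewrite yc; split=> //; exact: not_eq_sym.
apply: contrapT => yi; apply: hy; split.
  by move=> yw; apply: yi; rewrite yw.
have [->//|yc] := pselect (y = c).
by symmetry; apply: kp => //; rewrite wi; exact: not_eq_sym.
Qed.

Lemma aut_uniformly_perfect : uniformly_perfect aut.
Proof.
exists 2 => g /aut_rist_product[a [i [b [j [f [h [fR hR ->]]]]]]].
have [r [l [_ /(_ _ fR)[t [F [tR FR ->]]]]]] := rist_commutator a i.
have [r' [l' [_ /(_ _ hR)[t' [F' [tR' FR' ->]]]]]] := rist_commutator b j.
exists (fun n : 'I_2 => if n == ord0 then (t^-1)%g else (t'^-1)%g).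
exists (fun n : 'I_2 => if n == ord0 then F else F'); split.
  by move=> n; case: eqP => _; split; (apply: autV || idtac);
     [case: tR|case: FR|case: tR'|case: FR'].
by rewrite !big_ord_recl big_ord0 mulg1.
Qed.

Lemma aut_transitive x y : exists2 h, colored_iso h & h x = y.
Proof.
have [i _] := I2.
have [x' [xx' k1 k2]] := ktree_colors kP I2 x i i.
have [y' [yy' k3 k4]] := ktree_colors kP I2 y i i.
have [h [hP hx _]] : exists h, [/\ colored_iso h, h x = y & h x' = y'].
  by apply: colored_iso_two; rewrite ?k1 ?k2 //; exact: not_eq_sym.
by exists h.
Qed.

Lemma rist_commute r i (e f : sym T) : rist r i f -> (forall y, half r i y -> e y = y) ->
  (e * f = f * e)%g.
Proof.
move=> fR eE; apply: symP => y; rewrite !sym_mulE.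
have [hy|hy] := pselect (half r i y).
  by rewrite (eE y) // eE //; exact: rist_stable fR hy.
rewrite !(proj2 fR) // => hey; apply: hy.
by rewrite -(sym_injective (eE _ hey)).
Qed.

Lemma aut_simple : simple_group aut.
Proof.
split; first exact: aut_subgroup.
  have [x _] := T0; have [i _] := I2; have [y yx _] := ktree_color kP x i.
  have [h hP hx] := aut_transitive x y; move=> e.
  have : [set 1%g] h by rewrite -e; exact: colored_iso_aut.
  by move=> /= h1; apply: yx; rewrite -hx h1.
move=> N [/subgroupP[N1 NM NV] NA NJ].
have [|N0] := pselect (N = [set 1%g]); first by left.
right; apply/seteqP; split=> // g gA.
have [g0 Ng0 [r g0r]] : exists2 g, N g & exists r, g r <> r.
  apply: contrapT => H; apply: N0; apply/seteqP; split=> [h Nh /=|h ->//].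
  by apply: symP => y; apply: contrapT => hy; apply: H; exists h => //; exists y.
(* The first condition on [i] keeps [half r i] away from [g0 r]. The second makes its image leave
   [g0 r] in a direction other than that of [r], so that [r] sees the image in the direction of
   [g0 r]. *)
have [i ri rdisj] : exists2 i, k r (g0 r) <> i &
    forall y, half r i y -> ~ half r i (g0 y).
  have [s Gs sE] := NA _ Ng0 r.
  have [i [i1 i2]] := third_color (k r (g0 r)) (s^-1%g (k (g0 r) r)).
  exists i; first exact: not_eq_sym.
  move=> y [yr yi] [yr' yi']; apply: i1; rewrite -yi'.
  have d : k (g0 r) (g0 y) <> k (g0 r) r.
    by rewrite sE // yi => e; apply: i2; rewrite -e symVK.
  symmetry; apply: kp => //; try exact: not_eq_sym.
  exact: sym_neq.
(* [e] is supported in the image of [half r i] under [g0], so it commutes with [f2] and can be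
   inserted into the commutator. The product [f1 * e] is a conjugate of [g0] times [g0^-1], hence in
   [N]. *)
have comm f1 f2 : rist r i f1 -> rist r i f2 -> N [~ f1, f2]%g.
  move=> R1 R2; set e := (g0 * f1^-1 * g0^-1)%g.
  have eE y : half r i y -> e y = y.
    move=> hy; rewrite /e !sym_mulE (proj2 (ristV R1)) ?symKV //.
    by move=> /rdisj; rewrite symKV.
  have nN : N (f1 * e)%g.
    have -> : (f1 * e = g0 ^ (f1^-1) * g0^-1)%g.
      by rewrite conjgE invgK /e !mulgA.
    apply: NM; last exact: NV.
    by apply: NJ => //; apply: autV; case: R1.
  have -> : [~ f1, f2]%g = [~ (f1 * e), f2]%g.
    have e2 := rist_commute R2 eE.
    have e3 : (e * [~ f1, f2] = [~ f1, f2] * e)%g.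
      apply: rist_commute eE; rewrite commgEl conjgE.
      by do !apply: ristM => //; exact: ristV.
    move: (e) e2 e3 => x e2 e3; apply: (mulgI x); rewrite e3.
    by rewrite !commgEl !conjgE invgM !mulgA mulgV mul1g -!mulgA e2.
  rewrite commgEl; apply: NM; first exact: NV.
  by apply: NJ => //; case: R2.
(* The commutator expressing [f] takes place in a half-tree at [r']. A color-preserving map carries
   it into [half r i]: move [r'] to a point [b] there that sees [r] in a color other than [j']. *)
have Nrist x j f : rist x j f -> N f.
  have [r' [j' [_ H]]] := rist_commutator x j => /H[t [F [tR FR ->]]].
  have [l [lj _]] := third_color j' j'.
  have [b [br kb kbr]] := ktree_colors kP I2 r i l.
  have sub : half b j' `<=` half r i.
    by rewrite -kb; apply: half_sub; rewrite ?kbr //; exact: not_eq_sym.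
  have [h hP hr] := aut_transitive r' b.
  have hR f' : rist r' j' f' -> rist r i (f' ^ h^-1)%g.
    move=> R'; apply: (rist_sub sub); rewrite -hr conjgE invgK mulgA.
    apply: (@rist_conj r' j' f' h 1%g) => //; first exact: colored_iso_aut.
    by move=> y yr; rewrite hP //; exact: not_eq_sym.
  have -> : [~ t^-1, F]%g = ([~ (t^-1) ^ h^-1, F ^ h^-1] ^ h)%g.
    by rewrite conjRg !conjgKV.
  apply: NJ; first exact: colored_iso_aut.
  by apply: comm; apply: hR => //; exact: ristV.
have [a [j [b [l [f [h [fR hR ->]]]]]]] := aut_rist_product gA.
by apply: NM; [exact: Nrist fR|exact: Nrist hR].
Qed.

(** Pairs with the same two mutual colors are in one orbit, so [E] is a union of color types,
    recorded by [R]. One type yields all those with distinct colors, and two such steps join any two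
    points. *)
Lemma aut_primitive : perm_primitive aut.
Proof.
split.
  move=> x y; have [h hP hx] := aut_transitive x y.
  by exists h => //; exact: colored_iso_aut.
move=> E [Er Es Et] EG.
have [E1|] := pselect (forall x y, E x y -> x = y).
  by left=> x y; split=> [/E1//|->].
move=> /existsNP[x0 /existsNP[y0 /not_implyP[Exy xy]]]; right.
pose R i j := forall u v, u <> v -> k u v = i -> k v u = j -> E u v.
have typed u v : u <> v -> E u v -> R (k u v) (k v u).
  move=> uv Euv u' v' uv' e1 e2.
  have [h [hP <- <-]] := colored_iso_two uv uv' e1 e2.
  exact: (proj1 (EG h u v (colored_iso_aut hP)) Euv).
have RC i j : R i j -> R j i.
  by move=> H u v uv e1 e2; apply: Es; apply: H => //; exact: not_eq_sym.
(* A point [z] between [x] and [y] that sees [y] in color [i] forms with [y] a pair of the same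
   type, so transitivity relates [x] to [z], whose color towards [x] is free apart from [i]. *)
have step i j c : R i j -> c <> i -> R i c.
  move=> H ci.
  have [x _] := T0; have [y [yx kxy kyx]] := ktree_colors kP I2 x i j.
  have xy' : x <> y by exact: not_eq_sym.
  have [z [[zx zy _] kzx kzy kxz kyz]] := ktree_betweenP kP xy' ci.
  have Exz : E x z.
    apply: Et (H _ _ xy' kxy kyx) _; apply: Es; apply: H => //.
    by rewrite kyz.
  by rewrite -kxy -kxz -kzx; apply: typed => //; exact: not_eq_sym.
have Rall (a b : I) : a <> b -> R a b.
  have H := typed _ _ xy Exy.
  set i := k x0 y0 in H; set j := k y0 x0 in H.
  have Hi c : c <> i -> R i c by exact: step H.
  have H' c d : c <> i -> d <> c -> R c d by move=> /Hi/RC/step; exact.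
  move=> ab; have [ai|ai] := pselect (a = i).
    by subst a; apply: Hi; exact: not_eq_sym.
  by apply: H' => //; exact: not_eq_sym.
move=> u w; have [->//|uw] := pselect (u = w).
have [b [bu _]] := third_color (k u w) (k u w).
have [c [cw cb]] := third_color (k w u) b.
have bc : b <> c by exact: not_eq_sym.
have [v [[vu vw _] kvu kvw kuv kwv]] := ktree_betweenP kP uw bc.
have Euv : E u v by apply: (Rall (k u w) b) => //; exact: not_eq_sym.
by apply: Et Euv _; apply: (Rall c (k w u)).
Qed.

Lemma aut_doubly_transitive : doubly_transitive aut <-> perm_transitive Gamma.
Proof.
split=> [[_ tr2] i j|Gtr].
  have [x _] := T0.
  have [y yx ky] := ktree_color kP x i; have [z zx kz] := ktree_color kP x j.
  pose y' : ~` [set x] := SigSub (mem_set (yx : (~` [set x]) y)).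
  pose z' : ~` [set x] := SigSub (mem_set (zx : (~` [set x]) z)).
  have [p [g [gA gx] pE] pyz] := tr2 x y' z'.
  have [s Gs sE] := gA x; exists s => //.
  rewrite -ky -sE // gx -kz; congr (k x _).
  by have := pE y'; rewrite pyz.
split; first by case: aut_primitive.
move=> x y z; have yx := set_valP y; have zx := set_valP z.
have [s Gs sE] := Gtr (k x (val y)) (k x (val z)).
have [t Gt tE] := Gtr (k (val y) x) (k (val z) x).
have [h [hx hy h1 h2 h3]] := ktree_two_point I2 (s := s) (t := t) cT kP
  (not_eq_sym yx) (not_eq_sym zx) (esym sE) (esym tE).
have hA : aut h.
  move=> u; have [->|ux] := pselect (u = x).
    by exists s => // v vx; rewrite hx h1.
  have [->|uy] := pselect (u = val y); first by exists t => // v vy; rewrite hy h2.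
  by exists 1%g => // v vu; rewrite h3 //; exact: not_eq_sym.
have [u|p pE] := @restrict_sym _ (~` [set x]) h.
  split=> /= ux e; apply: ux; first by rewrite e.
  by rewrite -hx in e; exact: sym_injective e.
exists p; first by exists h.
by apply: val_inj; rewrite pE.
Qed.

(** Having the same color at [x] is an invariant relation of the stabilizer. [y] and [z] share a
    color and differ in how they see [x]; [w] has another color. *)
Lemma aut_not_doubly_primitive : ~ doubly_primitive aut.
Proof.
move=> [_ prim2]; have [x _] := T0; have [_ H] := prim2 x.
have [i [j ij]] := I2.
have [y [yx kxy kyx]] := ktree_colors kP I2 x i i.
have [z [zx kxz kzx]] := ktree_colors kP I2 x i j.
have [w wx kxw] := ktree_color kP x j.
pose mk v (vx : v <> x) : ~` [set x] := SigSub (mem_set (vx : (~` [set x]) v)).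
have [||E1|E2] := H (fun y z : ~` [set x] => k x (val y) = k x (val z)).
- by split=> // a b c -> ->.
- move=> p b c [g [gA gx] pE]; rewrite !pE; have [s Gs sE] := gA x.
  have bx := set_valP b; have cx := set_valP c.
  have gE v : v <> x -> k x (g v) = s (k x v) by rewrite -{2}gx; exact: sE.
  rewrite /point_action !gE //; split=> [->//|]; exact: sym_injective.
- have /(congr1 val) /= yz : mk y yx = mk z zx by apply/E1; rewrite /= kxy kxz.
  by apply: ij; rewrite -kyx -kzx yz.
- by apply: ij; have := E2 (mk y yx) (mk w wx); rewrite /= kxy kxw.
Qed.

(** * Point stabilizers as wreath products *)

Section Stabilizer.
Variable x : T.

Lemma swap_sym i j : exists s : sym I, s i = j.
Proof.
pose f l := if pselect (l = i) then j else if pselect (l = j) then i else l.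
have fi : f i = j by rewrite /f; case: pselect.
have fj : f j = i by rewrite /f; case: pselect => //; case: pselect.
have fl l : l <> i -> l <> j -> f l = l by rewrite /f; do 2 case: pselect.
have fK : cancel f f.
  move=> l; have [->|li] := pselect (l = i); first by rewrite fi.
  have [->|lj] := pselect (l = j); first by rewrite fj.
  by rewrite !fl.
by exists (Sym fK fK).
Qed.

Lemma aut_local_action s : Gamma s -> exists2 h, aut h /\ h x = x
  & forall y, y <> x -> k x (h y) = s (k x y).
Proof.
move=> Gs; have [i _] := I2.
have [y [yx kxy kyx]] := ktree_colors kP I2 x i i.
have [z [zx kxz kzx]] := ktree_colors kP I2 x (s i) i.
have [||h [hx hy h1 h2 h3]] := ktree_two_point I2 (s := s) (t := 1%g) cT kP
  (not_eq_sym yx) (not_eq_sym zx).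
- by rewrite kxz kxy.
- by rewrite kzx kyx.
exists h; last exact: h1.
split=> // u; have [->|ux] := pselect (u = x).
  by exists s => // v vx; rewrite hx h1.
have [->|uy] := pselect (u = y); first by exists 1%g => // v vy; rewrite hy h2.
by exists 1%g => // v vu; rewrite h3 //; exact: not_eq_sym.
Qed.

(* [m i] exchanges the colors [i0] and [i] at [x] only, so it need not belong
   to [aut]. *)
Lemma half_transport (i0 : I) : exists m : I -> sym T, forall i,
  [/\ m i x = x, forall u v, u <> x -> u <> v -> k (m i u) (m i v) = k u v
    & forall u, u <> x -> k x (m i u) = i <-> k x u = i0].
Proof.
suff H : forall i, exists h : sym T,
    [/\ h x = x, forall u v, u <> x -> u <> v -> k (h u) (h v) = k u v
    & forall u, u <> x -> k x (h u) = i <-> k x u = i0].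
  by have [m mP] := choice H; exists m.
move=> i; have [s si] := swap_sym i0 i.
have [y [yx kxy kyx]] := ktree_colors kP I2 x i0 i0.
have [z [zx kxz kzx]] := ktree_colors kP I2 x i i0.
have [||h [hx hy h1 h2 h3]] := ktree_two_point I2 (s := s) (t := 1%g) cT kP
  (not_eq_sym yx) (not_eq_sym zx).
- by rewrite kxz kxy si.
- by rewrite kzx kyx.
exists h; split=> // [u v ux uv|u ux].
  have [uy|uy] := pselect (u = y); last exact: h3.
  by subst u; rewrite hy h2 //; exact: not_eq_sym.
by rewrite h1 // -si; split=> [|->//]; exact: sym_injective.
Qed.

(** The maps [n i j], through a base color [i0], form a system of transports between half-trees at
    [x] that compose coherently. Conjugation by them identifies the factors, and permuting the
    half-trees by them realizes Gamma. *)
Lemma stabilizer_wreath :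
  isog_wreath (stabilizer aut x) (fun i => rist x i) Gamma.
Proof.
have [i0 _] := I2; have [m mP] := half_transport i0.
have [n nD] : exists n, forall i j, n i j = (m j * (m i)^-1)%g.
  by exists (fun i j => m j * (m i)^-1)%g.
have nn i j l : (n j l * n i j = n i l)%g by rewrite !nD mulgA mulgVK.
have nV i j : ((n i j)^-1 = n j i)%g by rewrite !nD invgM invgK.
have nE i : n i i = 1%g by rewrite !nD mulgV.
have nx i j : n i j x = x.
  have [mi _ _] := mP i; have [mj _ _] := mP j.
  by rewrite !nD sym_mulE -{1}mi symVK.
have mVx i u : u <> x -> ((m i)^-1)%g u <> x.
  by move=> ux e; apply: ux; have [mi _ _] := mP i; rewrite -(symKV (m i) u) e.
have nneq i j u : u <> x -> n i j u <> x.
  by rewrite -{2}(nx i j); exact: sym_neq.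
have nk i j u v : u <> x -> u <> v -> k (n i j u) (n i j v) = k u v.
  move=> ux uv; have [_ mi _] := mP i; have [_ mj _] := mP j.
  rewrite !nD !sym_mulE mj; [|exact: mVx|exact: sym_neq].
  rewrite -mi ?symKV //; [exact: mVx|exact: sym_neq].
have nc i j u : u <> x -> k x (n i j u) = j <-> k x u = i.
  move=> ux; have [_ _ mi] := mP i; have [_ _ mj] := mP j.
  have e := mj _ (mVx i u ux); have e' := mi _ (mVx i u ux).
  rewrite symKV in e'.
  by rewrite !nD sym_mulE; split=> [/e/e'|/e'/e].
have nh i j u : half x i u -> half x j (n i j u).
  by move=> [ux ui]; split; [exact: nneq|apply/nc].
pose phi i j g := (n i j * g * (n i j)^-1)%g.
(* [n i j] need not lie in [aut], but the conjugate does: away from [x] transport keeps colors, and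
   at [x] both [g] and its conjugate have trivial local action. *)
have phiR i j g : rist x i g -> rist x j (phi i j g).
  move=> gR; have [gA gE] := gR.
  have out y : ~ half x j y -> phi i j g y = y.
    move=> hy; rewrite /phi !sym_mulE gE ?symKV // => h.
    by apply: hy; rewrite -(symKV (n i j) y); exact: nh.
  have gx : g x = x by apply: gE => -[].
  split=> // y; have [->|yx] := pselect (y = x).
    exists 1%g => // z zx; have [hz|hz] := pselect (half x j z); last first.
      by rewrite !out //; case.
    rewrite (out x) /phi; last by case.
    have hz' : half x i ((n i j)^-1%g z) by rewrite nV; exact: nh.
    have [_ kz] := nh i j _ (rist_stable gR hz').
    by case: hz => _ hz; rewrite !sym_mulE kz hz.
  have [s Gs sE] := gA ((n i j)^-1%g y); exists s => // z zy.
  have y'x : (n i j)^-1%g y <> x by rewrite nV; exact: nneq.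
  have zy' : (n i j)^-1%g z <> (n i j)^-1%g y by exact: sym_neq.
  rewrite /phi !sym_mulE nk; last exact/not_eq_sym/sym_neq; last first.
    by rewrite -{1}gx; exact: sym_neq.
  rewrite sE // nV nk //; exact: not_eq_sym.
have phiM i j g h : phi i j (g * h)%g = (phi i j g * phi i j h)%g.
  by rewrite /phi !mulgA mulgVK.
have phi3 i j l g : phi j l (phi i j g) = phi i l g.
  by rewrite /phi !nV !mulgA nn -[LHS]mulgA nn.
have phi1 i g : phi i i g = g by rewrite /phi nE mul1g invg1 mulg1.
have phiE : coherent_isoms (fun i => rist x i) phi.
  split=> [i j|i g _|i j l g _]; [split|exact: phi1|exact: phi3].
    split; first by move=> g; exact: phiR.
      by move=> g h _ _ e; rewrite -(phi1 i g) -(phi3 i j i) e phi3 phi1.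
    move=> g gR; exists (phi j i g); first exact: phiR.
    by rewrite phi3 phi1.
  by move=> g h _ _; exact: phiM.
exists phi => //.
(* A pair transports each half-tree to its new color and then applies the factor belonging to that
   color. A trivial first component gives the complement isomorphic to Gamma. *)
pose W (u : (I -> sym T) * sym I) (F : sym T) := [/\ aut F, F x = x
  & forall i y, half x i y -> F y = (u.1 (u.2 i) * n i (u.2 i))%g y].
have uh u i y : wreath (fun i => rist x i) Gamma u ->
    half x i y -> half x (u.2 i) ((u.1 (u.2 i) * n i (u.2 i))%g y).
  by move=> [uR _] hy; apply: rist_stable (uR _) _; exact: nh.
have exF u : wreath (fun i => rist x i) Gamma u -> exists F, W u F.
  move=> [uR uG].
  have [|i|i y yx|i y hy|F [FA Fx FE Fk]] :=
    @star_glue x u.2 (fun i => u.1 (u.2 i) * n i (u.2 i))%g.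
  - exact: uG.
  - by rewrite sym_mulE nx (proj2 (uR _)) // => -[].
  - rewrite sym_mulE (rist_outside (uR (u.2 i))); [exact: nc|by case|exact: nneq].
  - have [s Gs sE] := proj1 (uR (u.2 i)) (n i (u.2 i) y).
    exists s => // z zy; rewrite !sym_mulE sE; last exact: sym_neq.
    by rewrite nk //; case: hy.
  exists F; split=> // i y [yx yi]; rewrite FE // yi //.
have uniqF u F F' : W u F -> W u F' -> F = F'.
  move=> [_ Fx FE] [_ F'x F'E]; apply: symP => y.
  have [->|yx] := pselect (y = x); first by rewrite Fx F'x.
  by rewrite (FE (k x y)) // (F'E (k x y)).
pose Phi u := xget 1%g (W u).
have PhiP u : wreath (fun i => rist x i) Gamma u -> W u (Phi u).
  by move=> /exF[F WF]; apply: xgetPex; exists F.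
exists Phi; split; last first.
  move=> u v uW vW; have [uR uG] := uW; have [vR vG] := vW.
  have wW : wreath (fun i => rist x i) Gamma (wreath_mul phi u v).
    split=> /= [i|]; last by case: (subgroupP Gamma).1 => // _ GM _; exact: GM.
    by apply: ristM; [exact: uR|apply: phiR; exact: vR].
  apply: (uniqF _ _ _ (PhiP _ wW)).
  have [uA ux uE] := PhiP _ uW; have [vA vx vE] := PhiP _ vW.
  split; [exact: autM|by rewrite sym_mulE vx|].
  move=> i y hy; have hy' := uh _ _ _ vW hy.
  transitivity (Phi u (Phi v y)) => //.
  rewrite (vE _ _ hy) (uE _ _ hy') -sym_mulE; congr (sym_fun _ _).
  pose l := u.2 (v.2 i).
  change (u.1 l * n (v.2 i) l * (v.1 (v.2 i) * n i (v.2 i)) = u.1 l *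
    phi ((u.2^-1)%g l) l (v.1 ((u.2^-1)%g l)) * n i l)%g.
  by rewrite {2 3}/l symVK /phi nV -!mulgA nn.
have PhiE u i y : wreath (fun i => rist x i) Gamma u -> half x i y ->
    Phi u y = (u.1 (u.2 i) * n i (u.2 i))%g y.
  by move=> /PhiP[_ _]; exact.
split.
- by move=> u /PhiP[FA Fx _].
- move=> u v; rewrite !inE => uW vW e.
  have e2 : u.2 = v.2.
    apply: symP => i; have [y hy1 hy2] := ktree_color kP x i.
    have hy : half x i y by [].
    have [_ <-] := uh _ _ _ uW hy; have [_ <-] := uh _ _ _ vW hy.
    by rewrite -!PhiE // e.
  have e1 : u.1 = v.1.
    apply/funext => j; apply: symP => y.
    have [hy|hy] := pselect (half x j y); last first.
      by rewrite (proj2 (proj1 uW j)) // (proj2 (proj1 vW j)).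
    have hz := nh j ((u.2^-1)%g j) y hy; set z := n j _ y in hz.
    have := PhiE _ _ _ uW hz; rewrite e (PhiE _ _ _ vW hz) -e2 symKV !sym_mulE /z.
    by rewrite -(sym_mulE (n _ _)) nn nE.
  by case: u v {uW vW e} e1 e2 => [u1 u2] [v1 v2] /= -> ->.
- move=> g [gA gx].
  have [s Gs] := gA x; rewrite gx => sE.
  have hg i y : half x i y -> half x (s i) (g y).
    move=> [yx yi]; split; last by rewrite sE // yi.
    by rewrite -gx; exact: sym_neq.
  (* The factor of [g] at color [j]: transport the half-tree back to the color it comes from under
     [s], then apply [g]. *)
  have ex j : exists f, rist x j f /\
      forall y, half x j y -> f y = (g * n j ((s^-1)%g j))%g y.
    set l := (s^-1)%g j.
    have [|y yx|y hy|f fR fE] := @cut x j (g * n j l)%g.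
    - by rewrite sym_mulE nx gx.
    - rewrite sym_mulE sE; last exact: nneq.
      have [nc1 nc2] := nc j l y yx; split=> [e|/nc2->]; last exact: symKV.
      by apply: nc1; apply: (@sym_injective _ s); rewrite e /l symKV.
    - have [yx _] := hy; have [t Gt tE] := gA (n j l y); exists t => // z zy.
      by rewrite !sym_mulE tE ?nk //; exact: sym_neq.
    by exists f.
  have [f fP] := choice ex.
  have uW : wreath (fun i => rist x i) Gamma (f, s).
    by split=> //= i; case: (fP i).
  exists (f, s) => //; apply: uniqF (PhiP _ uW) _; split=> // i y hy.
  change (g y = (f (s i) * n i (s i))%g y).
  have [_ fE] := fP (s i); rewrite sym_mulE fE; last exact: nh.
  by rewrite symVK -sym_mulE -mulgA nn nE mulg1.
Qed.

End Stabilizer.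

End Automorphisms.

(** * Components of the complement of a point *)

Lemma compact_finite_cover (X : topologicalType) (A : set X) (J : choiceType)
    (D : set J) (f : J -> set X) : compact A -> (forall j, D j -> open (f j)) ->
  A `<=` cover D f -> finite_subset_cover D f A.
Proof.
have [[x0 _]|/set0P/negP/negPn/eqP ->] := pselect (A !=set0); last first.
  by exists fset0 => //; move=> ?; rewrite inE.
pose pX : ptopologicalType := HB.pack (Topological.sort X) (isPointed.Build X x0).
by move=> cA; have : @compact pX A := cA; rewrite compact_cover; exact.
Qed.

Lemma metrizable_second_countable (R : realType) (X : topologicalType) :
  metrizable R X -> compact [set: X] -> [set: X] !=set0 ->
  exists2 B : set (set X), countable B &
    forall V x, open V -> V x -> exists2 U, B U & U x /\ U `<=` V.
Proof.
move=> [M [f [g [fC gC _ _ [gf fg]]]]] cX [x0 _].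
have {}gC := (continuous_subspace_setT g).2 gC.
have cM : compact [set: M].
  have -> : [set: M] = f @` [set: X].
    by apply/seteqP; split=> // y _; exists (g y) => //; exact: fg.
  exact: (continuous_compact _ cX).
pose pM : pseudoPMetricType R := HB.pack (Metric.sort M) (isPointed.Build M (f x0)).
have [B cB [oB bB]] := @compact_second_countable R pM cM.
exists ((fun U => g @` U) @` B); first exact: sub_countable (card_image_le _ _) cB.
move=> V x oV Vx.
have gV : nbhs (f x : pM) (g @^-1` V).
  by apply: gC; rewrite gf //; exact: open_nbhs_nbhs.
have [U [BU Ux] UV] := bB (f x) _ gV.
exists (g @` U); first by exists U.
by split=> [|_ [z /UV Vz <-] //]; exists (f x) => //; exact: gf.
Qed.

Lemma metrizable_hausdorff (R : realType) (X : topologicalType) :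
  metrizable R X -> hausdorff_space X.
Proof.
move=> [M [f [g [fC _ _ _ [gf _]]]]] x y xy.
have {}fC := (continuous_subspace_setT f).2 fC.
rewrite -(gf x) // -(gf y) //; congr g; apply: metric_hausdorff.
move=> A B /fC Ax /fC By; have [z [Az Bz]] := xy _ _ Ax By; by exists (f z).
Qed.

Section Components.
Variable X : topologicalType.
Hypotheses (HX : hausdorff_space X) (LX : locally_connected X).
Hypothesis CX : connected [set: X].
Implicit Types x y z w p q : X.

Lemma comp_at_refl x y : y <> x -> comp_at x y y.
Proof. by move=> yx; exact: connected_component_refl. Qed.

Lemma comp_at_neq x y z : comp_at x y z -> z <> x.
Proof. by move/connected_component_sub. Qed.

Lemma comp_at_same x y z : comp_at x y z -> comp_at x y = comp_at x z.
Proof. exact: same_connected_component. Qed.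

Lemma comp_at_eq x y z : z <> x -> comp_at x y = comp_at x z -> comp_at x y z.
Proof. by move=> zx ->; exact: comp_at_refl. Qed.

Lemma comp_at_connected x y z (A : set X) : connected A -> ~ A x -> A y -> A z ->
  comp_at x y = comp_at x z.
Proof.
move=> cA Ax Ay Az; apply: same_connected_component.
by apply: connected_component_max Ay _ cA _ Az => w Aw wx; apply: Ax; rewrite -wx.
Qed.

Lemma open_compl1 x : open (~` [set x]).
Proof.
apply: closed_openC; apply: accessible_closed_set1; exact: hausdorff_accessible.
Qed.

Lemma comp_at_open x y : open (comp_at x y).
Proof.
rewrite openE => z yz; rewrite /interior.
have zx := comp_at_neq yz.
have [V [oV Vz cV VU]] := LX (open_nbhs_nbhs (conj (open_compl1 x) zx)).
apply: filterS (open_nbhs_nbhs (conj oV Vz)) => w Vw.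
have Vx : ~ V x by move=> /VU; exact.
apply: comp_at_eq; first by move=> wx; apply: Vx; rewrite -wx.
by rewrite (comp_at_same yz); exact: comp_at_connected cV Vx Vz Vw.
Qed.

Lemma comp_at_nbhs x y : y <> x -> nbhs y (comp_at x y).
Proof.
by move=> yx; apply: open_nbhs_nbhs; split; [exact: comp_at_open|exact: comp_at_refl].
Qed.

(** Otherwise the component would be open and closed in the connected space [X] without containing
    [x]. *)
Lemma comp_at_closure x y : y <> x -> closure (comp_at x y) x.
Proof.
move=> yx; apply: contrapT => ncl.
have clE : closure (comp_at x y) = comp_at x y.
  apply/seteqP; split; last exact: subset_closure.
  move=> z cz; have zx : z <> x by move=> zx; apply: ncl; rewrite zx in cz.
  have [w [yw zw]] := cz _ (comp_at_nbhs zx).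
  by apply: comp_at_eq => //; rewrite (comp_at_same yw) -(comp_at_same zw).
have E : comp_at x y = [set: X].
  apply: CX; first by exists y; exact: comp_at_refl.
    by exists (comp_at x y); [exact: comp_at_open|rewrite setTI].
  exists (comp_at x y); last by rewrite setTI.
  by rewrite closure_id clE.
have : comp_at x y x by rewrite E.
by move/comp_at_neq.
Qed.

(** The closure of the component of [y] at [z] is connected and contains [y] and [z]. It misses [x],
    which has a neighborhood inside another component at [z]. *)
Lemma comp_at_pretree : pretree (@comp_at X).
Proof.
move=> x y z xz yz d.
apply: (@comp_at_connected _ _ _ (closure (comp_at z y))).
- by apply: connected_closure; exact: component_connected.
- move=> cx; have [w [yw xw]] := cx _ (comp_at_nbhs xz).
  by apply: d; rewrite (comp_at_same xw) (comp_at_same yw).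
- exact: comp_at_closure.
- by apply: subset_closure; exact: comp_at_refl.
Qed.

Lemma open_other_comp w x : open [set p | p <> w /\ comp_at w p <> comp_at w x].
Proof.
rewrite openE => p [pw d]; apply: filterS (comp_at_nbhs pw).
by move=> q pq; split; [exact: comp_at_neq pq|rewrite -(comp_at_same pq)].
Qed.

Local Notation sep := (separates (@comp_at X)).

Lemma Homeo_comp_at g x y : @Homeo X g -> comp_at (g x) (g y) = g @` comp_at x y.
Proof.
have image (h : sym X) u v : continuous (h : X -> X) ->
    h @` comp_at u v `<=` comp_at (h u) (h v).
  move=> hC; have [vu|vu] := pselect (v = u).
    have -> : comp_at u v = set0 by apply: connected_component_out; rewrite vu /=; apply.
    by rewrite image_set0.
  apply: connected_component_max.
  - by exists v => //; exact: comp_at_refl.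
  - move=> _ [w vw <-] /= e; apply: (comp_at_neq vw); exact: sym_injective e.
  - apply: connected_continuous_connected; first exact: component_connected.
    exact: continuous_subspaceT.
move=> [gC gVC]; apply/seteqP; split; last exact: image.
move=> z hz; exists ((g^-1)%g z); last by rewrite symKV.
have := image (g^-1)%g (g x) (g y) gVC; rewrite !symVK; apply.
by exists z.
Qed.

Lemma three_comp_Br m x y z : sep m x y -> sep m x z -> sep m y z -> Br m.
Proof.
move=> [mx my xy] [_ mz xz] [_ _ yz].
pose f (i : 'I_3) := if i == 0%N :> nat then comp_at m x else
  if i == 1%N :> nat then comp_at m y else comp_at m z.
have fI : {in [set: 'I_3] &, injective f}.
  move=> [i ltni] [j ltnj] _ _; rewrite /f /= => fij; apply: val_inj => /=.
  have yx := not_eq_sym xy; have zx := not_eq_sym xz; have zy := not_eq_sym yz.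
  by case: i ltni fij => [|[|[|i]]]; case: j ltnj => [|[|[|j]]].
rewrite /Br /= -(card_le_eql (inj_card_eq fI)); apply: subset_card_le.
move=> _ [i _ <-]; rewrite /f /hat /=.
by do 2?[case: ifP => _]; eexists => //; exact/not_eq_sym.
Qed.

Lemma connected_cover (A O U : set X) : connected A -> open O -> open U ->
  A `&` O !=set0 -> A `<=` O `|` U -> A `&` O `&` U = set0 -> A `<=` O.
Proof.
move=> cA oO oU AO AOU AOU0.
have <- : A `&` O = A; last by move=> x [].
apply: cA => //; first by exists O.
exists (~` U); first exact: open_closedC.
apply/seteqP; split=> x [Ax]; last by move=> Ux; split=> //; case: (AOU _ Ax).
by move=> Ox; split=> // Ux; have : (A `&` O `&` U) x by []; rewrite AOU0.
Qed.

Hypothesis SEP : forall x y, x <> y -> exists2 w, Br w & sep w x y.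

Let kp := comp_at_pretree.

(** [O] is the set of points cut off from [p] by a branch point that also cuts off [x]; [U] is
    defined likewise from points outside [O]. They are open and cover the connected component of [x]
    at [p], so disjointness puts [y] in [O]. *)
Lemma sep_common p x y : p <> x -> p <> y -> comp_at p x = comp_at p y ->
  exists w, [/\ Br w, sep w p x & sep w p y].
Proof.
move=> px py e.
pose O := \bigcup_(w in [set w | Br w /\ sep w p x])
  [set r | r <> w /\ comp_at w r <> comp_at w p].
pose U := \bigcup_(w in [set w | Br w /\ exists2 q, ~ O q & sep w p q])
  [set r | r <> w /\ comp_at w r <> comp_at w p].
have OP r w : r <> w /\ comp_at w r <> comp_at w p -> w <> p -> sep w p r.
  by move=> [rw d] wp; split.
suff /(_ y) : comp_at p x `<=` O.
  case; first by apply: comp_at_eq => //.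
  move=> w [Bw sw] /= hy; exists w; split=> //; apply: OP hy _; by case: sw.
apply: (@connected_cover _ O U).
- exact: component_connected.
- by apply: bigcup_open => w _; exact: open_other_comp.
- by apply: bigcup_open => w _; exact: open_other_comp.
- exists x; split; first exact: comp_at_refl.
  have [w Bw sw] := SEP px; exists w => //; case: sw => _ wx d; split=> //.
- move=> r pr; have [Or|Or] := pselect (O r); [by left|right].
  have rp := comp_at_neq pr.
  have [w Bw sw] := SEP (not_eq_sym rp); exists w; first by split=> //; exists r.
  by case: sw => _ wr d; split=> //.
- apply/seteqP; split=> // r [[_ [w [Bw sx] /OP sr]] [w' [Bw' [q Oq sq]] /OP sr']].
  have {}sr : sep w p r by apply: sr; case: sx.
  have {}sr' : sep w' p r by apply: sr'; case: sq.
  apply: Oq.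
  (* [w] and [w'] both lie between [p] and [r], so one of them is nearer to [p], and it separates
     [p] from both [x] and [q]. *)
  suff : sep w p q \/ sep w' p x.
    case=> [[wp wq d]|s']; first by exists w => //; split=> //; exact: not_eq_sym.
    by exists w' => //; case: sq => _ w'q d; split=> //; exact: not_eq_sym.
  have [ww'|ww'] := pselect (w = w'); first by left; rewrite ww'.
  have [wp wr dr] := sr; have [w'p w'r dr'] := sr'.
  have [e'|d] := pselect (comp_at w p = comp_at w w'); last first.
    by left; apply: (sep_trans kp sq).
  right; apply: (sep_trans kp sx); split=> //.
  by rewrite (@kp w' r w) // -e'.
Qed.

(** Two points of a connected open set are separated by a branch point, which must lie in the set. A
    singleton cannot be open in a connected space with two points. *)
Lemma dense_Br (U : set X) x0 y0 : x0 <> y0 -> open U -> U !=set0 ->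
  exists2 b, Br b & U b.
Proof.
move=> xy0 oU [p Up].
have [V [oV Vp cV VU]] := LX (open_nbhs_nbhs (conj oU Up)).
have [[q Vq qp]|Vq] := pselect (exists2 q, V q & q <> p).
  have [w Bw sw] := SEP qp; exists w => //; apply: VU; apply: contrapT => Vw.
  by case: sw => _ _; apply; exact: comp_at_connected Vw Vq Vp.
have VE : V = [set p].
  apply/seteqP; split=> [q Vq'|_ ->//]; apply: contrapT => qp; apply: Vq.
  by exists q.
have pT : [set p] = [set: X].
  apply: CX; first by exists p.
    by exists [set p]; rewrite ?setTI // -VE.
  exists [set p]; last by rewrite setTI.
  apply: accessible_closed_set1; exact: hausdorff_accessible.
have E u : u = p by have : [set p] u by rewrite pT.
by case: xy0; rewrite (E x0) (E y0).
Qed.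

(** [O] is swept out by the components of [x] at branch points separating [x] from both [y] and [z].
    It is open and misses [y], so by connectedness it has a boundary point [p], which is the
    median. *)
Lemma median_Br x y z : x <> y -> x <> z -> y <> z ->
  comp_at x y = comp_at x z -> comp_at y x = comp_at y z ->
  comp_at z x = comp_at z y ->
  exists m, [/\ Br m, sep m x y, sep m x z & sep m y z].
Proof.
move=> xy xz yz ex ey ez.
pose F w := [/\ Br w, sep w x y & sep w x z].
pose O := \bigcup_(w in F) comp_at w x.
have oO : open O by apply: bigcup_open => w _; exact: comp_at_open.
have Ox : O x.
  have [w Fw] := sep_common xy xz ex; exists w => //.
  by case: Fw => _ [wx _ _] _; exact: comp_at_refl.
have Oy : ~ O y by move=> [w [_ [_ wy d] _] /comp_at_same].
have [p cp Op] : exists2 p, closure O p & ~ O p.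
  apply: contrapT => H; apply: Oy; have -> : O = [set: X]; last by [].
  apply: CX; first by exists x.
    by exists O; rewrite ?setTI.
  exists O; rewrite ?setTI // closure_id; apply/seteqP; split.
    exact: subset_closure.
  by move=> p cp; apply: contrapT => Op; apply: H; exists p.
have px : p <> x by move=> px; apply: Op; rewrite px.
(* Otherwise a branch point [w] cuts [p] off from both [x] and [t]. A component [comp_at w1 x] of
   the union comes close to [p], and comparing [w] with [w1] puts [p] into that component. *)
have clA t : (forall w, F w -> sep w x t) -> p <> t -> comp_at p x <> comp_at p t.
  move=> Ft pt e; have [w [Bw sx st]] := sep_common px pt e.
  have [wp wx dx] := sx; have [_ wt dt] := st.
  have [q [[w1 F1 q1] qw]] := cp _ (comp_at_nbhs (not_eq_sym wp)).
  have wqp := comp_at_same qw; have w1qx := comp_at_same q1.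
  have qw' := comp_at_neq qw; have qw1 := comp_at_neq q1.
  have [w1x w1t d1] := Ft _ F1.
  have ww1 : w <> w1 by move=> ww1; subst w1; apply: dx; rewrite wqp w1qx.
  have e1 : comp_at w1 w = comp_at w1 x.
    apply: contrapT => d.
    have h1 := @kp w x w1 ww1 (not_eq_sym w1x) d.
    have d' : comp_at w1 w <> comp_at w1 q by rewrite -w1qx.
    have h2 := @kp w q w1 ww1 qw1 d'.
    by apply: dx; rewrite wqp -h2.
  apply: dt; have -> : comp_at w t = comp_at w w1.
    by symmetry; apply: kp => //; rewrite e1.
  have [->//|pw1] := pselect (p = w1).
  symmetry; apply: kp => // e2; apply: Op; exists w1 => //.
  by apply: comp_at_eq => //; rewrite -e1.
have py : p <> y.
  move=> py; subst p; apply: (clA z) => //; by move=> w [].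
have pz : p <> z.
  move=> pz; subst p; apply: (clA y) => //; by move=> w [].
have sy : sep p x y by split=> //; apply: clA => // w [].
have sz : sep p x z by split=> //; apply: clA => // w [].
have syz : sep p y z.
  split=> // e; have [w [Bw wpy wpz]] := sep_common py pz e.
  have [_ _ dxy] := sy; have [wp wy dy] := wpy; have [_ wz dz] := wpz.
  have wx : w <> x.
    move=> wx; subst w; apply: dxy; exact: (sep_gate kp wpy).
  have ewx : comp_at w x = comp_at w p.
    apply: contrapT => d; apply: dxy; rewrite -(sep_gate kp wpy).
    by symmetry; apply: (sep_gate kp); split=> //; exact: not_eq_sym.
  apply: Op; exists w; last by apply: comp_at_eq => //; exact: not_eq_sym.
  by split=> //; split=> //; rewrite ewx.
by exists p; split=> //; exact: three_comp_Br sy sz syz.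
Qed.

Lemma Br_subbasis p (U : set X) : compact [set: X] -> open U -> U p ->
  exists2 D : {fset X}, (forall b, b \in D -> Br b /\ b <> p) &
    forall q, (forall b, b \in D -> comp_at b p q) -> U q.
Proof.
move=> cX oU Up.
have cU : compact (~` U).
  by apply: subclosed_compact cX _ => //; exact: open_closedC.
have [||D sD cov] := @compact_finite_cover X (~` U) X [set b | Br b /\ b <> p]
  (fun b => [set q | q <> b /\ comp_at b q <> comp_at b p]) cU.
- by move=> b _; exact: open_other_comp.
- move=> q Uq; have pq : p <> q by move=> pq; apply: Uq; rewrite -pq.
  have [b Bb [bp bq d]] := SEP pq; exists b => //; split=> //.
exists D; first by move=> b /sD; rewrite inE.
move=> q Dq; apply: contrapT => /cov[b bD [_ d]].
by apply: d; rewrite (comp_at_same (Dq b bD)).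
Qed.

(** If [b] and [b'] differ, two of the three points lie at [b] outside the direction of [b']. Then
    [b'] sees both in the direction of [b] and does not separate them. *)
Lemma median_unique b b' x y z : sep b x y -> sep b x z -> sep b y z ->
  sep b' x y -> sep b' x z -> sep b' y z -> b = b'.
Proof.
have key u v : sep b u v -> sep b' u v -> comp_at b u <> comp_at b b' ->
    comp_at b v <> comp_at b b' -> b = b'.
  move=> [bu bv _] [b'u b'v d'] du dv; apply: contrapT => bb'.
  by apply: d'; rewrite -(@kp b' u b) ?(@kp b' v b) //; exact: not_eq_sym.
move=> bxy bxz byz b'xy b'xz b'yz.
have [_ _ dxy] := bxy; have [_ _ dxz] := bxz; have [_ _ dyz] := byz.
have [ex|ex] := pselect (comp_at b x = comp_at b b').
  apply: key byz b'yz _ _; rewrite -ex; exact: not_eq_sym.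
have [ey|ey] := pselect (comp_at b y = comp_at b b'); last exact: key bxy b'xy ex ey.
apply: key bxz b'xz ex _; rewrite -ey; exact: not_eq_sym.
Qed.

Lemma Br_three_comp b : Br b -> exists x y z, [/\ sep b x y, sep b x z & sep b y z].
Proof.
move=> /pcard_leP[f].
have fh (i : 'I_3) : exists2 y, y <> b & f i = comp_at b y.
  by have [y yb e] := @funS _ _ _ _ f i Logic.I; exists y.
have fI (i j : 'I_3) : i != j -> f i <> f j.
  by move=> /eqP ij e; apply: ij; apply: (@inj _ _ _ f) => //; rewrite inE.
have [x xb ex] := fh 0%R; have [y yb ey] := fh 1%R; have [z zb ez] := fh 2%R.
exists x, y, z; rewrite /separates -ex -ey -ez.
by split; split=> //; try exact: not_eq_sym; exact: fI.
Qed.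

(** A branch point is recovered from three members of a countable base lying in three different
    components at it, by uniqueness of medians. *)
Lemma Br_countable (R : realType) : metrizable R X -> compact [set: X] ->
  countable (@Br X).
Proof.
move=> mX cX.
have [[b0 Bb0]|noB] := pselect (exists b, @Br X b); last first.
  rewrite (_ : @Br X = set0) //; apply/seteqP; split=> // b Bb.
  by apply: noB; exists b.
have [|B cB bB] := metrizable_second_countable mX cX; first by exists b0.
pose P b (u : set X * set X * set X) := [/\ (B `*` B `*` B) u,
  u.1.1 !=set0 /\ u.1.2 !=set0, u.2 !=set0 & forall x y z,
  u.1.1 x -> u.1.2 y -> u.2 z -> [/\ sep b x y, sep b x z & sep b y z]].
have H b : exists u, Br b -> P b u.
  have [Bb|nb] := pselect (Br b); last by exists (set0, set0, set0).
  have [x [y [z [xy xz yz]]]] := Br_three_comp Bb.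
  have [bx by_ dxy] := xy; have [_ bz dxz] := xz; have [_ _ dyz] := yz.
  have [U BU [Ux UV]] := bB _ x (comp_at_open b x) (comp_at_refl (not_eq_sym bx)).
  have [U' BU' [Uy UV']] := bB _ y (comp_at_open b y) (comp_at_refl (not_eq_sym by_)).
  have [U'' BU'' [Uz UV'']] := bB _ z (comp_at_open b z) (comp_at_refl (not_eq_sym bz)).
  exists (U, U', U'') => _; split=> //=.
  - by split; [exists x|exists y].
  - by exists z.
  move=> x' y' z' /UV hx /UV' hy /UV'' hz.
  rewrite /separates -(comp_at_same hx) -(comp_at_same hy) -(comp_at_same hz).
  have := comp_at_neq hx; have := comp_at_neq hy; have := comp_at_neq hz.
  by split; split=> //; exact: not_eq_sym.
have [f fP] := choice H.
have fI : {in @Br X &, injective f}.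
  move=> b b'; rewrite !inE => /fP[_ [[x fx] [y fy]] [z fz] hb] /fP[_ _ _ hb'] e.
  have [h1 h2 h3] := hb _ _ _ fx fy fz.
  rewrite e in fx fy fz; have [h4 h5 h6] := hb' _ _ _ fx fy fz.
  exact: (median_unique h1 h2 h3).
rewrite /countable -(card_le_eql (inj_card_eq fI)).
apply: sub_countable (countableX (countableX cB cB) cB).
by apply: subset_card_le => _ [b /fP[? _ _ _] <-].
Qed.

(** * Extending permutations of the branch points to homeomorphisms *)

Section Extension.
Hypothesis cX : compact [set: X].
Variables x0 y0 : X.
Hypothesis xy0 : x0 <> y0.
Let T : Type := @Br X.
Implicit Types (b : T) (g : sym T).
Local Notation K := (@comp_at X).

Definition comp_preserving g := forall b u v, b <> u -> b <> v ->
  K (val b) (val u) = K (val b) (val v) <->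
  K (val (g b)) (val (g u)) = K (val (g b)) (val (g v)).

(* The graph of the extension of [g] to [X]; it is symmetric under inversion
   of [g], so only existence and uniqueness of the image are to be proved. *)
Definition ext_rel g p q := forall b u, p <> val b -> q <> val (g b) -> b <> u ->
  K (val b) p = K (val b) (val u) <-> K (val (g b)) q = K (val (g b)) (val (g u)).

Lemma comp_preservingV g : comp_preserving g -> comp_preserving (g^-1)%g.
Proof.
move=> gP b u v bu bv; rewrite (gP ((g^-1)%g b)) ?symKV //.
- exact: sym_neq.
- exact: sym_neq.
Qed.

Lemma ext_relV g p q : ext_rel g p q -> ext_rel (g^-1)%g q p.
Proof.
move=> gpq b u qb pb bu; rewrite (gpq ((g^-1)%g b) ((g^-1)%g u)) ?symKV //.
exact: sym_neq.
Qed.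

Lemma ext_rel_Br g b : comp_preserving g -> ext_rel g (val b) (val (g b)).
Proof.
move=> gP b' u bb' _ b'u; apply: gP => // e; apply: bb'; by rewrite e.
Qed.

Lemma Br_in (U : set X) p : open U -> U p -> exists b : T, U (val b).
Proof.
move=> oU Up; have [|b Bb Ub] := dense_Br xy0 oU; first by exists p.
by exists (SigSub (mem_set Bb)).
Qed.

Lemma sep_Br p q : p <> q -> exists b : T, sep (val b) p q.
Proof. by move=> /SEP[b Bb s]; exists (SigSub (mem_set Bb)). Qed.

(** Two images would be separated by some [g b] with [b] different from [p]. A branch point [u] in
    the direction of [p] at [b] then fixes the direction of both images at [g b]. *)
Lemma ext_rel_unique g p q q' : comp_preserving g ->
  ext_rel g p q -> ext_rel g p q' -> q = q'.
Proof.
move=> gP gq gq'; apply: contrapT => qq'.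
have [b [bp [bq bq' d]]] : exists b, p <> val b /\ sep (val (g b)) q q'.
  have [c sc] := sep_Br qq'.
  have [pc|pc] := pselect (p = val ((g^-1)%g c)); last first.
    by exists ((g^-1)%g c); rewrite symKV.
  have [cq _ _] := sc; have [c' sc'] := sep_Br (not_eq_sym cq).
  have c'c : c' <> c by move=> e; case: sc' => _; rewrite e.
  exists ((g^-1)%g c'); rewrite symKV; split; last exact: (sep_trans kp sc).
  by rewrite pc => /val_inj e; apply: c'c; exact: (sym_injective (esym e)).
have [u hu] := Br_in (comp_at_open (val b) p) (comp_at_refl bp).
have bu : b <> u by move=> e; apply: (comp_at_neq hu); rewrite e.
have e := comp_at_same hu; apply: d.
by rewrite (gq _ _ bp (not_eq_sym bq) bu).1 ?(gq' _ _ bp (not_eq_sym bq') bu).1.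
Qed.

(** If every [q] violates some condition, compactness leaves finitely many conditions that no [q]
    satisfies together. But [g v] satisfies them for a branch point [v] close enough to [p]. The set
    [D] lists one implication only; [inD] yields the other. *)
Lemma ext_rel_exists g p : comp_preserving g -> exists q, ext_rel g p q.
Proof.
move=> gP; apply: contrapT => noq.
pose D := [set bu : set_type (@Br X) * set_type (@Br X) |
  [/\ p <> val bu.1, bu.1 <> bu.2 & K (val bu.1) p = K (val bu.1) (val bu.2)]].
have [||E sE cov] := @compact_finite_cover X [set: X] _ D (fun bu => [set q |
    q <> val (g bu.1) /\ K (val (g bu.1)) q <> K (val (g bu.1)) (val (g bu.2))]) cX.
- by move=> bu _; exact: open_other_comp.
- move=> q _; apply: contrapT => ncov; apply: noq; exists q => b u pb qb bu.
  have inD v : b <> v -> K (val b) p = K (val b) (val v) ->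
      K (val (g b)) q = K (val (g b)) (val (g v)).
    move=> bv e; apply: contrapT => d; apply: ncov.
    by exists (b, v).
  split=> [|e]; first exact: inD.
  have [v hv] := Br_in (comp_at_open (val b) p) (comp_at_refl pb).
  have bv : b <> v by move=> e'; apply: (comp_at_neq hv); rewrite e'.
  rewrite (comp_at_same hv); apply/(gP b v u bv bu).
  by rewrite -(inD v) //; exact: comp_at_same hv.
have pE : nbhs p (\bigcap_(bu in [set` E]) comp_at (val bu.1) p).
  apply: filter_bigI => bu /sE; rewrite inE => -[pb _ _].
  exact: comp_at_nbhs pb.
move: pE; rewrite nbhsE => -[V [oV Vp] VE].
have [v Vv] := Br_in oV Vp.
have [[b u] buE [gvb]] := cov (val (g v)) Logic.I; apply.
have := sE _ buE; rewrite inE => -[/= pb bu e].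
have hv := VE _ Vv _ buE.
have bv : b <> v by move=> e'; apply: (comp_at_neq hv); rewrite e'.
by apply/(gP b v u bv bu); rewrite -e -(comp_at_same hv).
Qed.

Lemma exists_extension g : comp_preserving g ->
  exists2 h : sym X, @Homeo X h & forall b, h (val b) = val (g b).
Proof.
move=> gP; have gVP := comp_preservingV gP.
have [f fP] := choice (fun p => ext_rel_exists p gP).
have [f' f'P] := choice (fun p => ext_rel_exists p gVP).
have fK : cancel f f'.
  move=> p; apply: (ext_rel_unique gVP (f'P _)); exact: ext_relV (fP p).
have f'K : cancel f' f.
  move=> p; apply: (ext_rel_unique gP (fP _)).
  by have := ext_relV (f'P p); rewrite invgK.
have cont (h : sym T) (F : X -> X) : comp_preserving h -> injective F ->
    (forall p, ext_rel h p (F p)) -> continuous F.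
  move=> hP FI FP p U; rewrite nbhsE => -[V [oV Vp] VU].
  have [D DB DV] := Br_subbasis cX oV Vp.
  have FE b : F (val b) = val (h b).
    apply: (ext_rel_unique hP (FP _)); exact: ext_rel_Br.
  have : nbhs p (\bigcap_(b in [set` D]) [set p1 | comp_at b (F p) (F p1)]).
    apply: filter_bigI => b /DB[Bb bFp].
    (* The component of [p] at the preimage [b'] of [b] is mapped into the component of [F p] at
       [b]. *)
    pose c : T := SigSub (mem_set Bb); pose b' := (h^-1)%g c.
    have hb' : h b' = c by rewrite symKV.
    have pb' : p <> val b'.
      by move=> pb'; apply: bFp; rewrite pb' FE hb'.
    have [u hu] := Br_in (comp_at_open (val b') p) (comp_at_refl pb').
    have bu : b' <> u by move=> e; apply: (comp_at_neq hu); rewrite e.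
    have FK p1 : p1 <> val b' -> K (val b') p1 = K (val b') (val u) ->
        F p1 <> b /\ K b (F p1) = K b (val (h u)).
      move=> pb1 e1; have Fb : F p1 <> b.
        by move=> e; apply: pb1; apply: FI; rewrite FE hb'.
      split=> //; have := FP p1 b' u pb1; rewrite hb' => /(_ Fb bu) H.
      exact: (proj1 H e1).
    apply: filterS (comp_at_nbhs pb').
    move=> p1 hp1 /=; have [F1 K1] := FK _ pb' (comp_at_same hu).
    have [||F2 K2] := FK p1; first exact: comp_at_neq hp1.
      by rewrite -(comp_at_same hp1) (comp_at_same hu).
    by apply: comp_at_eq => //; rewrite K1 K2.
  by apply: filterS => p1 hp1; apply: VU; apply: DV.
exists (Sym fK f'K).
  split; first by apply: (cont g) => //; exact: can_inj fK.
  by apply: (cont (g^-1)%g) => //; exact: can_inj f'K.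
move=> b; apply: (ext_rel_unique gP (fP _)); exact: ext_rel_Br.
Qed.

End Extension.

End Components.

(** * Transport along isomorphisms *)

Section Transport.
Variables (gT hT : groupType) (G : set gT) (f : gT -> hT).
Hypothesis GP : subgroup G.
Hypothesis fI : forall x y, G x -> G y -> f x = f y -> x = y.
Hypothesis fM : forall x y, G x -> G y -> f (x * y)%g = (f x * f y)%g.
Local Notation H := (f @` G).

Let G1 : G 1%g. Proof. by have [] := (subgroupP G).1 GP. Qed.
Let GM x y : G x -> G y -> G (x * y)%g.
Proof. by have [_ + _] := (subgroupP G).1 GP; apply. Qed.
Let GV x : G x -> G (x^-1)%g.
Proof. by have [_ _] := (subgroupP G).1 GP; apply. Qed.

Lemma transport1 : f 1%g = 1%g.
Proof. by apply: (mulgI (f 1%g)); rewrite -fM // !mulg1. Qed.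

Lemma transportV x : G x -> f (x^-1)%g = (f x)^-1%g.
Proof.
move=> Gx; apply: (mulgI (f x)); rewrite -fM ?mulgV ?transport1 //.
exact: GV.
Qed.

Lemma transport_subgroup : subgroup H.
Proof.
apply/subgroupP; split; first by exists 1%g => //; exact: transport1.
- move=> _ _ [x Gx <-] [y Gy <-]; exists (x * y)%g; [exact: GM|exact: fM].
- by move=> _ [x Gx <-]; exists (x^-1)%g; [exact: GV|exact: transportV].
Qed.

Lemma transport_simple : simple_group G -> simple_group H.
Proof.
move=> [_ Gn1 Gs]; split; first exact: transport_subgroup.
  move=> H1; apply: Gn1; apply/seteqP; split=> [x Gx|_ ->//].
  have : H (f x) by exists x.
  by rewrite H1 /= -transport1 => /fI; apply.
move=> N [/subgroupP[N1 NM NV] NH NJ].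
have [|E|E] := Gs [set x | G x /\ N (f x)].
- split=> [|x []//|g h Gg [Gh Nh]].
    apply/subgroupP; split=> [|x y [Gx Nx] [Gy Ny]|x [Gx Nx]] /=.
    + by rewrite transport1.
    + by rewrite fM //; split; [exact: GM|exact: NM].
    + by rewrite transportV //; split; [exact: GV|exact: NV].
  have GgV := GV Gg; have Ghg := GM Gh Gg.
  rewrite /= conjgE; split; first exact: GM.
  by rewrite !fM // transportV // -conjgE; apply: NJ => //; exists g.
- left; apply/seteqP; split=> [y Ny|_ ->//].
  have [x Gx fx] := NH _ Ny; have : [set x | G x /\ N (f x)] x by rewrite /= fx.
  by rewrite E /= -fx => ->; exact: transport1.
- right; apply/seteqP; split=> // _ [x Gx <-].
  by have : G x by []; rewrite -E => -[].
Qed.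

Lemma transport_uniformly_perfect : uniformly_perfect G -> uniformly_perfect H.
Proof.
move=> [m mP]; exists m => _ [g Gg <-]; have [a [b [ab ->]]] := mP g Gg.
exists (f \o a), (f \o b); split.
  by move=> i; have [Ga Gb] := ab i; split; [exists (a i)|exists (b i)].
suff [] : G (\prod_(i < m) [~ a i, b i])%g /\
  f (\prod_(i < m) [~ a i, b i])%g = (\prod_(i < m) [~ f (a i), f (b i)])%g by [].
have fR x y : G x -> G y -> G [~ x, y]%g /\ f [~ x, y]%g = [~ f x, f y]%g.
  move=> Gx Gy; have GxV := GV Gx; have GyV := GV Gy.
  rewrite !commgEl !conjgE; split; first by do !apply: GM => //.
  by rewrite !fM ?transportV //; do !apply: GM => //.
apply: (big_ind2 (fun x y => G x /\ f x = y)).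
- by split=> //; exact: transport1.
- by move=> x _ y _ [Gx <-] [Gy <-]; split; [exact: GM|exact: fM].
- by move=> i _; have [Ga Gb] := ab i; exact: fR.
Qed.

(** [f] is injective on [G] only, so the isomorphisms between factors are carried over through a
    partial inverse [f'] chosen on the image of [G]. *)
Lemma transport_wreath (S : set gT) (I : Type) (A : I -> set gT)
    (Gamma : set (sym I)) : S `<=` G -> (forall i, A i `<=` G) ->
  isog_wreath S A Gamma -> isog_wreath (f @` S) (fun i => f @` A i) Gamma.
Proof.
move=> SG AG [phi [phiI phi1 phi3] [F [[FS FI Fs] FM]]].
pose f' y := xget 1%g [set x | G x /\ f x = y].
have f'K x : G x -> f' (f x) = x.
  move=> Gx; have [] : [set z | G z /\ f z = f x] (f' (f x)).
    by apply: xgetPex; exists x.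
  by move=> h1 h2; apply: fI.
exists (fun i j y => f (phi i j (f' y))).
  split=> [i j|i _ [x Ax <-]|i j l _ [x Ax <-]].
  - have [[phiF phiJ phiS] phiM] := phiI i j; split; first split.
    + move=> _ [x Ax <-]; rewrite f'K; last exact: (AG _ _ Ax).
      by exists (phi i j x) => //; exact: phiF.
    + move=> y y'; rewrite !inE => -[x Ax <-] [x' Ax' <-].
      rewrite !f'K; [|exact: (AG _ _ Ax')|exact: (AG _ _ Ax)] => e; congr f.
      apply: phiJ; rewrite ?inE //; apply: fI e; apply: AG; exact: phiF.
    + move=> _ [x Ax <-]; have [z Az zx] := phiS _ Ax.
      by exists (f z); [exists z|rewrite f'K ?zx //; exact: (AG _ _ Az)].
    + move=> _ _ [x Ax <-] [x' Ax' <-]; have Gx := AG _ _ Ax; have Gx' := AG _ _ Ax'.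
      rewrite -fM // !f'K //; last exact: GM.
      by rewrite phiM // fM //; apply: AG; exact: phiF.
  - by rewrite f'K ?phi1 //; exact: (AG _ _ Ax).
  - have [[phiF _ _] _] := phiI i j.
    have Gx := AG _ _ Ax; have Gp := AG _ _ (phiF _ Ax).
    by rewrite !f'K // phi3.
pose lift (u : (I -> gT) * sym I) := (f \o u.1, u.2).
pose drop (u : (I -> hT) * sym I) := (f' \o u.1, u.2).
have dropW u : wreath (fun i => f @` A i) Gamma u -> wreath A Gamma (drop u).
  move=> [uA uG]; split=> //= i; have [x Ax <-] := uA i.
  by rewrite f'K //; exact: (AG _ _ Ax).
exists (fun u => f (F (drop u))); split; first split.
- by move=> u /dropW/FS SFu; exists (F (drop u)).
- move=> u v; rewrite !inE => uW vW e.
  have : drop u = drop v.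
    apply: FI; rewrite ?inE; [exact: dropW|exact: dropW|].
    by apply: fI e; apply: SG; apply: FS; exact: dropW.
  case: u v uW vW {e} => [u s] [v t] [uA _] [vA _] [e ->]; congr pair.
  apply/funext => i; have [x Ax /= xu] := uA i; have [y Ay /= yv] := vA i.
  have := congr1 (@^~ i) e; rewrite /= -xu -yv.
  by rewrite (f'K x (AG _ _ Ax)) (f'K y (AG _ _ Ay)) => ->.
- move=> _ [x Sx <-]; have [u [uA uG] ux] := Fs _ Sx.
  have liftW : wreath (fun i => f @` A i) Gamma (lift u).
    by split=> //= i; exists (u.1 i).
  exists (lift u) => //; rewrite -ux; congr (f (F _)).
  rewrite /drop /lift; case: u uA uG {ux liftW} => u s /= uA uG; congr pair.
  by apply/funext => i /=; rewrite f'K //; exact: (AG _ _ (uA i)).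
- move=> u v uW vW; have uW' := dropW _ uW; have vW' := dropW _ vW.
  rewrite -fM; [|by apply: SG; exact: FS|by apply: SG; exact: FS].
  rewrite -FM //; congr (f (F _)); rewrite /drop /wreath_mul /=; congr pair.
  apply/funext => i /=; set j := (u.2^-1%g) i.
  have [x Ax xu] := uW.1 i; have [y Ay yv] := vW.1 j.
  have [[phiF _ _] _] := phiI j i.
  have Gx := AG _ _ Ax; have Gy := AG _ _ Ay; have Gp := AG _ _ (phiF _ Ay).
  move: xu yv => /= <- <-; rewrite !f'K // -fM // f'K //; exact: GM.
Qed.

End Transport.

(** * Arcs *)

Section Arcs.
Variables (R : realType) (X : topologicalType).

(** Cutting the arc at [z] gives two connected sets that meet only in [z]; later arguments use arcs
    in this form. *)
Lemma open_segment_arc (x y z : X) : open_segment R x y z ->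
  [/\ z <> x, z <> y & exists A B : set X,
    [/\ connected A /\ connected B, A x /\ A z, B z /\ B y
      & forall w, A w -> B w -> w = z]].
Proof.
move=> [sz nz]; have zx : z <> x by move=> zx; apply: nz; left.
have zy : z <> y by move=> zy; apply: nz; right.
split=> //; move: sz; rewrite /segment.
(* Without an arc [segment] would be the default [set0], which has no point [z]. *)
have [[B0 arcB0]|noarc] := pselect (exists A, is_arc R x y A); last first.
  by rewrite xgetPN // => A arcA; apply: noarc; exists A.
have := @xgetPex _ set0 [set A | is_arc R x y A] (ex_intro _ B0 arcB0).
move: (xget _ _) => A [f [g [[fC _ fA gA [gf fg]] f0 f1]]] Az.
have /andP[t0 t1] : (0 <= g z <= 1)%R by have := gA _ Az; rewrite /= in_itv.
set t := g z in t0 t1; have ft : f t = z by exact: fg.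
have sub (a b : R) : (0 <= a)%R -> (b <= 1)%R ->
    `[a, b] `<=` (`[0%R, 1%R]%classic : set R).
  move=> a0 b1 s /=; rewrite !in_itv /= => /andP[h1 h2].
  by rewrite (le_trans a0 h1) (le_trans h2 b1).
have conn (a b : R) : (0 <= a)%R -> (b <= 1)%R -> connected (f @` `[a, b]).
  move=> a0 b1; apply: connected_continuous_connected; first exact: segment_connected.
  exact: continuous_subspaceW (sub _ _ a0 b1) fC.
exists (f @` `[0%R, t]), (f @` `[t, 1%R]); split.
- by split; exact: conn.
- split; [exists 0%R|exists t] => //=; rewrite in_itv /= ?lexx ?t0 //.
- split; [exists t|exists 1%R] => //=; rewrite in_itv /= ?lexx ?t1 //.
- move=> _ [s /= + <-] [r + e]; rewrite !in_itv /= => /andP[s0 st] /andP[tr r1].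
  have gs : g (f s) = s by apply: gf; rewrite /= in_itv /= s0 (le_trans st t1).
  have gr : g (f r) = r by apply: gf; rewrite /= in_itv /= r1 (le_trans t0 tr).
  have sr : s = r by rewrite -gs -gr e.
  by rewrite -ft; congr f; apply/le_anti; rewrite st sr tr.
Qed.

Local Notation sep := (separates (@comp_at X)).

(** A point separating the ends of one half of the arc must lie on that half, hence off the other
    one, which therefore stays within one of its components. *)
Lemma open_segment_sep (x y z w : X) : open_segment R x y z ->
  (sep w x z -> sep w x y) /\ (sep w z y -> sep w x y).
Proof.
move=> /open_segment_arc[zx zy [A [B [[cA cB] [Ax Az] [Bz By] AB]]]].
have nB : w <> z -> A w -> ~ B w by move=> wz Aw Bw; apply: wz; exact: AB.
split=> -[w1 w2 d].
  have Aw : A w by apply: contrapT => Aw; apply: d; exact: comp_at_connected cA Aw Ax Az.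
  have Bw := nB w2 Aw; split=> //; first by move=> wy; apply: Bw; rewrite wy.
  by rewrite -(comp_at_connected cB Bw Bz By).
have Bw : B w by apply: contrapT => Bw; apply: d; exact: comp_at_connected cB Bw Bz By.
have Aw : ~ A w by move=> Aw; apply: w1; exact: AB.
split=> //; first by move=> wx; apply: Aw; rewrite wx.
by rewrite (comp_at_connected cA Aw Ax Az).
Qed.

(* If no branch point separated [x] from [y], then none would separate [x]
   from a branch point [z1] of [(x, y)], nor [z1] from a branch point [z2] of
   [(x, z1)], against the kaleidoscopic property. *)
Lemma kaleidoscopic_sep n (c : X -> set X -> idx n) x y : wazewski R n X ->
  kaleidoscopic R c -> (exists i j : idx n, i <> j) -> x <> y ->
  exists2 w, Br w & sep w x y.
Proof.
move=> [_ _ _ segB] [_ kal] [i [j ij]] xy.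
have [z1 [z1s Bz1]] := segB _ _ xy.
have [z1x _ _] := open_segment_arc z1s.
have [z2 [z2s Bz2]] := segB _ _ (not_eq_sym z1x).
have [_ z21 _] := open_segment_arc z2s.
have [w [ws Bw wi wj]] := kal _ _ i j Bz2 Bz1 z21 ij.
have [w2 w1 _] := open_segment_arc ws.
exists w => //; apply: (open_segment_sep w z1s).1.
apply: (open_segment_sep w z2s).2; split=> // e.
by apply: ij; rewrite -wi -wj e.
Qed.

End Arcs.

(** * The kaleidoscopic group *)

Lemma three_colors (n : option nat) : three_le n ->
  exists a b c : idx n, [/\ a <> b, a <> c & b <> c].
Proof.
case: n => [[|[|[|m]]]|] // _; last by exists 0%N, 1%N, 2%N.
by exists (@Ordinal m.+3 0 isT), (@Ordinal m.+3 1 isT), (@Ordinal m.+3 2 isT).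
Qed.

Section Kaleidoscope.
Variables (R : realType) (n : option nat) (hn : three_le n).
Variables (Gamma : set (sym (idx n))) (hGamma : subgroup Gamma).
Variables (X : topologicalType) (hX : wazewski R n X).
Variables (c : X -> set X -> idx n) (hc : kaleidoscopic R c).
Local Notation K := (@comp_at X).
Local Notation sep := (separates K).
Local Notation T := (set_type (@Br X)).
Local Notation G := (kaleido_group c Gamma).

Let I3 := three_colors hn.

Let I2 : exists i j : idx n, i <> j.
Proof. by have [a [b [_ [ab _ _]]]] := I3; exists a, b. Qed.

Let HX : hausdorff_space X.
Proof. by have [[_ _ mX _ _] _ _ _] := hX; exact: metrizable_hausdorff mX. Qed.

Let cX : compact [set: X].
Proof. by have [[[_ ?] _ _ _ _] _ _ _] := hX. Qed.

Let CX : connected [set: X].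
Proof. by have [[_ ? _ _ _] _ _ _] := hX. Qed.

Let LX : locally_connected X.
Proof. by have [[_ _ _ ? _] _ _ _] := hX. Qed.

Let SEP x y : x <> y -> exists2 w, Br w & sep w x y.
Proof. by move=> xy; exact: kaleidoscopic_sep hX hc I2 xy. Qed.

Let K_pretree : pretree K := comp_at_pretree HX LX CX.

Lemma nondegenerate : exists x y : X, x <> y.
Proof. by have [_ ? _ _] := hX. Qed.

Lemma dense_branch (U : set X) p : open U -> U p -> exists b : T, U (val b).
Proof.
have [x0 [y0 xy0]] := nondegenerate => oU Up.
exact: (Br_in HX LX CX SEP xy0 oU Up).
Qed.

Definition color x y : idx n := c x (K x y).

Lemma hat_comp x y : y <> x -> hat x (K x y).
Proof. by move=> yx; exists y. Qed.

Lemma color_eq x y z : Br x -> y <> x -> z <> x ->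
  color x y = color x z <-> K x y = K x z.
Proof.
move=> Bx yx zx; rewrite /color; split=> [|->//].
have [[_ cI _] _] := (hc.1 _ Bx, tt).
by apply: cI; rewrite inE; exact: hat_comp.
Qed.

Lemma color_onto x i : Br x -> exists2 u : T, val u <> x & color x (val u) = i.
Proof.
move=> Bx; have [_ _ /(_ i Logic.I)[V [y yx <-] ci]] := hc.1 _ Bx.
have [u hu] := dense_branch (comp_at_open HX LX x y) (comp_at_refl yx).
by exists u; [exact: comp_at_neq hu|rewrite /color -(comp_at_same hu)].
Qed.

Lemma component_of_colorE x y : Br x -> y <> x ->
  component_of_color c x (color x y) = K x y.
Proof.
move=> Bx yx; rewrite /component_of_color.
have [|[z zx <-] e] := @xgetPex _ set0 [set V | hat x V /\ c x V = color x y].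
  by exists (K x y); split=> //; exact: hat_comp.
exact/(color_eq Bx zx yx).
Qed.

Definition kcolor (b u : T) : idx n := color (val b) (val u).

Lemma val_neq (b u : T) : b <> u -> val b <> val u.
Proof. by move=> bu /val_inj. Qed.

Lemma kcolor_sep b u v : separates kcolor b u v <-> sep (val b) (val u) (val v).
Proof.
split=> -[bu bv d].
  have bu' := val_neq bu; have bv' := val_neq bv; split=> // e; apply: d.
  apply/color_eq; [exact: set_valP|exact: not_eq_sym|exact: not_eq_sym|exact: e].
split; [by move=> e; apply: bu; rewrite e|by move=> e; apply: bv; rewrite e|].
move=> e; apply: d; apply/color_eq; [exact: set_valP| | |exact: e]; exact: not_eq_sym.
Qed.

Lemma kcolor_eq b u v : u <> b -> v <> b ->
  kcolor b u = kcolor b v <-> K (val b) (val u) = K (val b) (val v).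
Proof.
by move=> ub vb; apply: color_eq; [exact: set_valP|exact: val_neq|exact: val_neq].
Qed.

Lemma kcolor_ktree : ktree kcolor.
Proof.
split.
- move=> x y z xz yz d; have xy : x <> y by move=> e; apply: d; rewrite e.
  apply/kcolor_eq => //; apply: K_pretree; [exact: val_neq|exact: val_neq|].
  by move=> /kcolor_eq; auto.
- move=> x y z xy xz yz /kcolor_eq e1 /kcolor_eq e2 /kcolor_eq e3.
  have [||||||m [Bm s1 s2 s3]] := median_Br HX LX CX SEP
    (x := val x) (y := val y) (z := val z).
  1-3: exact: val_neq.
  1-3: by auto.
  by exists (SigSub (mem_set Bm)); split; apply/kcolor_sep.
- move=> x y i j xy ij.
  have [z [zs Bz zi zj]] := hc.2 _ _ i j (set_valP x) (set_valP y) (val_neq xy) ij.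
  have [zx zy _] := open_segment_arc zs.
  exists (SigSub (mem_set Bz)); split=> // e; [apply: zx|apply: zy];
    by rewrite -e.
- move=> x i; have [u ux e] := color_onto i (set_valP x).
  by exists u => // e'; apply: ux; rewrite e'.
Qed.

Lemma T_countable : countable [set: T].
Proof.
have [[_ _ mX _ _] _ _ _] := hX.
have /countable_injP[f fI] := Br_countable HX LX CX mX cX.
apply/countable_injP; exists (f \o val) => x y _ _ /= e.
by apply: val_inj; apply: fI; rewrite ?inE //; exact: set_valP.
Qed.

Lemma T_nonempty : [set: T] !=set0.
Proof.
by have [x [y /SEP[w Bw _]]] := nondegenerate; exists (SigSub (mem_set Bw)).
Qed.

Lemma Homeo_sep g x y z : @Homeo X g -> sep x y z -> sep (g x) (g y) (g z).
Proof.
move=> gH [xy xz d]; split; [exact: sym_neq|exact: sym_neq|].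
rewrite !Homeo_comp_at // => e; apply: d; apply/seteqP; split=> u hu.
  have : (g @` K x z) (g u) by rewrite -e; exists u.
  by case=> v hv e'; rewrite -(sym_injective e').
have : (g @` K x y) (g u) by rewrite e; exists u.
by case=> v hv e'; rewrite -(sym_injective e').
Qed.

Lemma HomeoV g : @Homeo X g -> @Homeo X (g^-1)%g.
Proof. by case=> gC gVC; split=> //; rewrite invgK. Qed.

Lemma Homeo_Br g x : @Homeo X g -> Br (g x) <-> Br x.
Proof.
have key h y : @Homeo X h -> Br y -> Br (h y).
  move=> hH /Br_three_comp[u [v [w [s1 s2 s3]]]].
  by apply: three_comp_Br (Homeo_sep hH s1) (Homeo_sep hH s2) (Homeo_sep hH s3).
move=> gH; split=> [|]; last exact: key.
by move=> /(key _ _ (HomeoV gH)); rewrite symVK.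
Qed.

(** Branch points are dense and [X] is Hausdorff. The set [U] is all of [X] for uniqueness of
    extensions and a single component for rigid stabilizers. *)
Lemma continuous_agree (U : set X) (f g : X -> X) x : continuous f -> continuous g ->
  open U -> (forall b : T, U (val b) -> f (val b) = g (val b)) -> U x -> f x = g x.
Proof.
move=> fC gC oU fg Ux; apply: HX => A B /fC fA /gC gB.
have : nbhs x (f @^-1` A `&` g @^-1` B `&` U).
  apply: filterI; [exact: filterI|exact: open_nbhs_nbhs].
rewrite nbhsE => -[V [oV Vx] VS].
have [b Vb] := dense_branch oV Vx; have [[Ab Bb] Ub] := VS _ Vb.
by exists (f (val b)); split=> //; rewrite fg.
Qed.

Lemma Homeo_eq g h : @Homeo X g -> @Homeo X h ->
  (forall b : T, g (val b) = h (val b)) -> g = h.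
Proof.
move=> [gC _] [hC _] gh; apply: symP => x.
by apply: (@continuous_agree setT) => //; exact: openT.
Qed.

Lemma kaleidoP g : G g <-> @Homeo X g /\ forall x, Br x ->
  exists2 s, Gamma s & forall y, y <> x -> color (g x) (g y) = s (color x y).
Proof.
split=> -[gH gP]; split=> // x Bx; have [s Gs sE] := gP x Bx; exists s => //.
  move=> y yx; rewrite sE /local_action component_of_colorE //.
  by rewrite /color Homeo_comp_at.
move=> i; have [u ux <-] := color_onto i Bx.
by rewrite -sE // /local_action component_of_colorE // /color Homeo_comp_at.
Qed.

Local Notation autT := (aut kcolor Gamma).

Lemma kaleido_restrict g : G g ->
  exists2 p : sym T, autT p & forall b, val (p b) = g (val b).
Proof.
move=> /kaleidoP[gH gP].
have [p pE] := restrict_sym (fun y => Homeo_Br y gH).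
exists p => // b; have [s Gs sE] := gP _ (set_valP b); exists s => // u ub.
by rewrite /kcolor !pE sE //; exact: val_neq.
Qed.

Lemma kaleido_extend p : autT p ->
  exists2 g, G g & forall b : T, g (val b) = val (p b).
Proof.
move=> pA; have [x0 [y0 xy0]] := nondegenerate.
have pC : comp_preserving p.
  move=> b u v bu bv; have [s Gs sE] := pA b.
  have ub := not_eq_sym bu; have vb := not_eq_sym bv.
  have pub := sym_neq (g := p) ub; have pvb := sym_neq (g := p) vb.
  rewrite -(kcolor_eq ub vb) -(kcolor_eq pub pvb) !sE //.
  by split=> [->//|]; exact: sym_injective.
have [g gH gE] := exists_extension HX LX CX SEP cX xy0 pC.
exists g => //; apply/kaleidoP; split=> // x Bx.
pose b : T := SigSub (mem_set Bx).
have [s Gs sE] := pA b; exists s => // y yx.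
(* The local action of [p] is given on branch points; [u] represents the component of [y]. *)
have [u hu] := dense_branch (comp_at_open HX LX x y) (comp_at_refl yx).
have ub : u <> b by move=> e; apply: (comp_at_neq hu); rewrite e.
have := sE u ub; rewrite /kcolor -!gE /color /= (comp_at_same hu) => <-.
by rewrite !Homeo_comp_at // (comp_at_same hu).
Qed.

Lemma perm_group_aut : perm_group_on G (@Br X) = autT.
Proof.
apply/seteqP; split=> p.
  move=> [g /kaleido_restrict[q qA qE] pE].
  have -> : p = q by apply: symP => b; apply: val_inj; rewrite pE qE.
  by [].
by move=> /kaleido_extend[g Gg gE]; exists g => // b; rewrite /point_action gE.
Qed.

Let kcolorP := kcolor_ktree.

(** The extensions are chosen independently of each other. They multiply correctly because
    homeomorphisms agreeing on branch points are equal. *)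
Lemma exists_iso : exists E : sym T -> sym X,
  [/\ forall p, autT p -> G (E p) /\ forall b : T, E p (val b) = val (p b),
      forall p q, autT p -> autT q -> E p = E q -> p = q,
      forall p q, autT p -> autT q -> E (p * q)%g = (E p * E q)%g
    & forall g, G g -> exists2 p, autT p & E p = g].
Proof.
have H p : exists g, autT p -> G g /\ forall b : T, g (val b) = val (p b).
  have [/kaleido_extend[g Gg gE]|np] := pselect (autT p); first by exists g.
  by exists 1%g.
have [E EP] := choice H; exists E.
have EH p : autT p -> @Homeo X (E p) by move=> /EP[/kaleidoP[]].
split=> // [p q pA qA e|p q pA qA|g Gg].
- apply: symP => b; apply: val_inj.
  by rewrite -(EP _ pA).2 -(EP _ qA).2 e.
- apply: Homeo_eq; first by apply: EH; exact: autM.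
    have [pC pVC] := EH _ pA; have [qC qVC] := EH _ qA; split.
      by move=> y; apply: continuous_comp; [exact: qC|exact: pC].
    by rewrite invgM; move=> y; apply: continuous_comp; [exact: pVC|exact: qVC].
  move=> b; rewrite (EP _ (autM hGamma pA qA)).2 !sym_mulE.
  by rewrite (EP _ qA).2 (EP _ pA).2.
- have [p pA pE] := kaleido_restrict Gg; exists p => //.
  apply: Homeo_eq; [exact: EH|by case/kaleidoP: Gg|].
  by move=> b; rewrite (EP _ pA).2 pE.
Qed.

Lemma kaleido_simple : simple_group G /\ uniformly_perfect G.
Proof.
have [E [EP EI EM ES]] := exists_iso.
have <- : E @` autT = G.
  apply/seteqP; split=> [_ [p pA <-]|g /ES[p pA <-]]; last by exists p.
  by case: (EP _ pA).
have aP := aut_subgroup kcolor hGamma; split.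
  apply: transport_simple => //.
  exact: aut_simple kcolorP T_countable hGamma T_nonempty I3.
apply: transport_uniformly_perfect => //.
exact: aut_uniformly_perfect kcolorP T_countable hGamma T_nonempty I3.
Qed.

(** * The stabilizer of a branch point and its blocks *)

Section Blocks.
Variables (x : X) (Bx : Br x).
Let b : T := SigSub (mem_set Bx).
Local Notation Kx := (stabilizer G x).
Local Notation Y := (@Br X `\ x).
Local Notation blocks := (traces (hat x) Y).

Lemma component_of_colorP i y :
  component_of_color c x i y <-> y <> x /\ color x y = i.
Proof.
have [u ux ui] := color_onto i Bx; rewrite -ui component_of_colorE //; split.
  move=> h; have yx := comp_at_neq h; split=> //.
  by rewrite /color (comp_at_same h).
by move=> [yx /(color_eq Bx yx ux) e]; apply: comp_at_eq.
Qed.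

Lemma stabilizer_isog_wreath : isog_wreath Kx
  (fun i => Rist G (component_of_color c x i)) Gamma.
Proof.
have [E [EP EI EM ES]] := exists_iso.
have -> : Kx = E @` stabilizer autT b.
  apply/seteqP; split=> [g [/ES[p pA <-] px]|_ [p [pA pb] <-]].
    exists p => //; split=> //; apply: val_inj.
    by rewrite -(EP _ pA).2.
  have [GE EE] := EP _ pA; split=> //.
  by have := EE b; rewrite pb.
have -> : (fun i => Rist G (component_of_color c x i)) =
    (fun i => E @` rist kcolor Gamma b i).
  apply/funext => i; apply/seteqP; split=> [g [/ES[p pA <-] pV]|_ [p [pA pV] <-]].
    exists p => //; split=> // u hu; apply: val_inj; rewrite -(EP _ pA).2.
    apply: pV => /component_of_colorP[ux ui]; apply: hu; split=> //.
    by move=> e; apply: ux; rewrite e.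
  have [GE EE] := EP _ pA; split=> // y yV.
  have [->|yx] := pselect (y = x).
    by have := EE b; rewrite pV // => -[].
  have [[EC _] _] := (kaleidoP (E p)).1 GE.
  (* Triviality off a half-tree is known at branch points. The whole component of [y] at [x] lies
     outside the half-tree, so it extends to [y] by density. *)
  apply: (@continuous_agree (K x y) _ id y EC) => //.
  - by move=> z; exact: cvg_id.
  - exact: comp_at_open.
  - move=> u hu /=; rewrite EE pV // => -[ub ui]; apply: yV.
    apply/component_of_colorP; split=> //; rewrite -ui /kcolor /color /=.
    by rewrite (comp_at_same hu).
  - exact: comp_at_refl.
have aP := aut_subgroup kcolor hGamma.
apply: (@transport_wreath _ _ autT E) => //.
- by move=> p [].
- by move=> i p [].
exact: stabilizer_wreath kcolorP T_countable hGamma I3 b.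
Qed.

Lemma Y_branch (y : Y) : Br (val y) /\ val y <> x.
Proof. exact: (set_valP y). Qed.

Lemma branch_Y z : Br z -> z <> x -> exists y : Y, val y = z.
Proof. by move=> Bz zx; exists (SigSub (mem_set (conj Bz zx : Y z))). Qed.

Lemma color_pair i j : exists y : Y, color x (val y) = i /\ color (val y) x = j.
Proof.
have [u [ub bu ub']] := ktree_colors kcolorP I2 b i j.
have ux : val u <> x by move=> e; apply: ub; apply: val_inj.
have [y yu] := branch_Y (set_valP u) ux.
by exists y; rewrite yu.
Qed.

Lemma blockP (B : set Y) : blocks B <->
  exists i, B = [set y : Y | color x (val y) = i].
Proof.
split=> [[_ [z zx <-] <-]|[i ->]].
  exists (color x z); apply/seteqP; split=> y /=; have [By yx] := Y_branch y.
    by move=> h; rewrite /color (comp_at_same h).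
  by move=> /(color_eq Bx yx zx) e; apply: comp_at_eq.
have [u ux ui] := color_onto i Bx; exists (K x (val u)); first exact: hat_comp.
apply/seteqP; split=> y /=; have [By yx] := Y_branch y.
  by move=> h; rewrite -ui /color (comp_at_same h).
by rewrite -ui => /(color_eq Bx yx ux) e; apply: comp_at_eq.
Qed.

Definition block i : set Y := [set y : Y | color x (val y) = i].

Lemma block_inj i j : block i = block j -> i = j.
Proof.
have [y [yi _]] := color_pair i i => e.
have : block j y by rewrite -e.
by rewrite /block /= yi.
Qed.

Lemma Kx_perm p : perm_group_on Kx Y p -> exists2 s, Gamma s &
  forall y, color x (val (p y)) = s (color x (val y)).
Proof.
move=> [g [Gg gx] pE]; have [_ /(_ x Bx)[s Gs]] := (kaleidoP g).1 Gg.
rewrite gx => sE; exists s => // y.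
by rewrite pE /point_action sE //; exact: (Y_branch y).2.
Qed.

Lemma image_block (p : sym Y) s i :
  (forall y, color x (val (p y)) = s (color x (val y))) -> injective s ->
  image_action p (block i) = block (s i).
Proof.
move=> pc sI; apply/seteqP; split=> [_ [y yi <-]|y yi].
  by rewrite /block /= pc yi.
by exists ((p^-1)%g y); [apply: sI; rewrite -pc symKV|exact: symKV].
Qed.

Lemma blocks_imprimitive : system_of_imprimitivity (perm_group_on Kx Y) blocks.
Proof.
have blockB i : blocks (block i) by apply/blockP; exists i.
split.
- split.
  + apply/seteqP; split=> // y _; exists (block (color x (val y))) => //.
  + by move=> A B /blockP[i ->] /blockP[j ->] [y [/= <- <-]].
  + move=> A /blockP[i ->]; have [y [yi _]] := color_pair i i; by exists y.
- move=> p _ /Kx_perm[s Gs sE] /blockP[i ->].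
  by rewrite (image_block i sE (@sym_injective _ s)).
- have [i [j ij]] := I2; exists (block i), (block j); split=> //.
  by move=> /block_inj.
(* Two points of one block are told apart by the colors in which they see [x]. *)
- move=> A /blockP[i ->]; have [j [l jl]] := I2.
  have [y [yi yj]] := color_pair i j; have [z [zi zl]] := color_pair i l.
  by exists y, z; split=> // e; apply: jl; rewrite -yj -zl e.
Qed.

Lemma blocks_action : perm_isomorphic
  (induced_perms (perm_group_on Kx Y) (@image_action Y) blocks) Gamma.
Proof.
have blockB i : blocks (block i) by apply/blockP; exists i.
pose mk i : blocks := SigSub (mem_set (blockB i)).
have [f fP] : exists f : blocks -> idx n, forall B, val B = block (f B).
  have H (B : blocks) : exists i, val B = block i.
    by have /blockP[i] := set_valP B; exists i.
  by have [f fP] := choice H; exists f.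
have fmk i : f (mk i) = i by apply: block_inj; rewrite -fP.
have mkf B : mk (f B) = B by apply: val_inj; rewrite /= -fP.
exists f; first by exists mk.
move=> q; split=> [Gq|[p [r /Kx_perm[s Gs sE] pE] qE]]; last first.
  have -> : q = s; last by [].
  apply: symP => i; rewrite -(fmk i) qE; apply: block_inj.
  by rewrite -fP pE /= (image_block i sE (@sym_injective _ s)) fmk.
(* An element of Gamma is realized on the branch points with local action [q] at [x], extended to
   [X], then restricted to [Y] and passed to the blocks. *)
have [h [hA hb] hE] := aut_local_action kcolorP T_countable hGamma I3 b Gq.
have [g Gg gE] := kaleido_extend hA.
have gx : g x = x by have := gE b; rewrite hb.
have gY y : Y (g y) <-> Y y.
  have gH := ((kaleidoP g).1 Gg).1.
  split=> -[/(Homeo_Br y gH) By yx]; split=> // e; apply: yx.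
    by rewrite e.
  by apply: (@sym_injective _ g); rewrite gx.
have [r rE] := restrict_sym gY.
have rq y : color x (val (r y)) = q (color x (val y)).
  have [By yx] := Y_branch y; pose u : T := SigSub (mem_set By).
  have ub : u <> b by move=> e; apply: yx; have := congr1 val e.
  by rewrite rE -[val y]/(val u) gE -(hE u ub).
have imK (t : sym Y) : cancel (image_action t) (image_action (t^-1)%g).
  move=> B; rewrite /image_action image_comp; apply/seteqP.
  split=> [_ [y By <-]|y By] /=; first by rewrite (sym_funK t).
  by exists y => //=; rewrite (sym_funK t).
have imVK (t : sym Y) : cancel (image_action (t^-1)%g) (image_action t).
  by move=> B; have := imK (t^-1)%g B; rewrite invgK.
have rB B : blocks (Sym (imK r) (imVK r) B) <-> blocks B.
  have qI := @sym_injective _ q.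
  split=> /blockP[i /= e]; last by rewrite e (image_block i rq qI).
  have -> : B = block ((q^-1)%g i); last exact: blockB.
  apply: (can_inj (imK r)); rewrite e (image_block _ rq qI).
  by rewrite symKV.
have [p pE] := restrict_sym rB.
exists p; first by exists r => //; exists g.
move=> B; apply: block_inj; rewrite -fP pE /=.
by rewrite fP (image_block _ rq (@sym_injective _ q)).
Qed.

End Blocks.

End Kaleidoscope.

Theorem theorem1p1 (R : realType) (n : option nat) (hn : three_le n)
    (Gamma : set (sym (idx n))) (hGamma : subgroup Gamma)
    (X : topologicalType) (hX : wazewski R n X)
    (c : X -> set X -> idx n) (hc : kaleidoscopic R c) :
  [/\ simple_group (kaleido_group c Gamma) /\ uniformly_perfect (kaleido_group c Gamma),
      perm_primitive (perm_group_on (kaleido_group c Gamma) (@Br X)) /\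
      (doubly_transitive (perm_group_on (kaleido_group c Gamma) (@Br X)) <->
       perm_transitive Gamma),
      ~ doubly_primitive (perm_group_on (kaleido_group c Gamma) (@Br X))
    & forall x : X, Br x ->
      let Kx := stabilizer (kaleido_group c Gamma) x in
      let Y := @Br X `\ x in
      let blocks := traces (hat x) Y in
      [/\ system_of_imprimitivity (perm_group_on Kx Y) blocks,
          perm_isomorphic
            (induced_perms (perm_group_on Kx Y) (@image_action Y) blocks) Gamma
        & isog_wreath Kx
            (fun i : idx n => Rist (kaleido_group c Gamma) (component_of_color c x i))
            Gamma]].
Proof.
have kP := kcolor_ktree hn hX hc; have cT := T_countable hX.
have T0 := T_nonempty hn hX hc; have I3 := three_colors hn.
rewrite !(perm_group_aut hn Gamma hX hc); split.
- exact: (kaleido_simple hn hGamma hX hc).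
- split; first exact: (aut_primitive kP cT hGamma T0 I3).
  exact: (aut_doubly_transitive kP cT hGamma T0 I3).
- exact: (aut_not_doubly_primitive kP T0 I3).
move=> x Bx /=; split.
- exact: (blocks_imprimitive hn Gamma hX hc Bx).
- exact: (blocks_action hn hGamma hX hc Bx).
- exact: (stabilizer_isog_wreath hn hGamma hX hc Bx).
Qed.
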